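(* For $n\in\mathbb{N}$ let $\varepsilon_n:=\zeta_3\big(\widetilde{\mathrm{B}_{n,\frac12}},\mathrm{N}\big)$ and $$L_n:=\frac16\left\{\begin{array}{ll}\left|\left(2n^{\frac12}+n^{-\frac12}-n^{-\frac32}\right)\mathrm{b}_{n,\frac12}\big(\lfloor\tfrac n2\rfloor\big)-\frac{4}{\sqrt{2\pi}}\right| & \text{if $n$ is odd},\\[2mm] \left|2n^{\frac12}\,\mathrm{b}_{n,\frac12}\big(\tfrac n2\big)-\frac{4}{\sqrt{2\pi}}\right| & \text{if $n$ is even}.\end{array}\right.$$ Then $L_n=\frac{1}{6\sqrt{2\pi}\,n}+O\!\left(\frac1{n^2}\right)$ as $n\to\infty$, and for every $n\in\mathbb{N}$ $$L_n=\left|\int\frac{|x|^3}{6}\,d\widetilde{\mathrm{B}_{n,\frac12}}(x)-\int\frac{|x|^3}{6}\,d\mathrm{N}(x)\right|\ \le\ \varepsilon_n\ <\ \frac{1}{3\sqrt{2\pi}\,n}+\left(\frac{4+\zeta(\frac12)}{\sqrt{2\pi}}-1\right)\frac{1}{6n^{3/2}}\ <\ \frac{0.1330}{n}+\frac{0.0022}{n^{3/2}}\ \le\ \frac{0.1352}{n},$$ where $\zeta(\cdot)$ is the Riemann zeta-function, in particular $\zeta(\frac12)=-1.4603\ldots$.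
   Context: $\mathrm{B}_{n,\frac12}$ is the binomial law with $\mathrm{B}_{n,\frac12}(\{k\})=\mathrm{b}_{n,\frac12}(k):=\binom nk2^{-n}$ for $k\in\mathbb{N}_0$; $\widetilde{\mathrm{B}_{n,\frac12}}$ is its standardization, i.e. the image under $x\mapsto(x-\frac n2)/\sqrt{n/4}$. $\mathrm{N}$ is the standard normal law on $\mathbb{R}$. Zolotarev distance of order 3: for probability laws $P,Q$ on $\mathbb{R}$, $\zeta_3(P,Q):=\sup_{f\in\mathcal{F}_3^\infty}\left|\int f\,dP-\int f\,dQ\right|$, where $\mathcal{F}_3^\infty$ is the set of bounded, twice continuously differentiable functions $f:\mathbb{R}\to\mathbb{R}$ with $|f''(x)-f''(y)|\le|x-y|$ for all $x,y\in\mathbb{R}$. (The symbol $\zeta$ without subscript is the Riemann zeta-function.) *)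

(* Defs.v *)
From HB Require Import structures.
From mathcomp Require Import all_boot all_order all_algebra.
From mathcomp Require Import all_classical all_reals all_analysis.

Set Implicit Arguments.
Unset Strict Implicit.
Unset Printing Implicit Defensive.

Import Order.TTheory GRing.Theory Num.Theory.
Import numFieldNormedType.Exports.

Local Open Scope classical_set_scope.
Local Open Scope ring_scope.

Section laws.
Context {R : realType}.

Definition b_half (n k : nat) : R := 'C(n, k)%:R / 2 ^+ n.

Definition standardize (n k : nat) : measurableTypeR R :=
  (k%:R - n%:R / 2) / Num.sqrt (n%:R / 4).

Lemma measurable_standardize n : measurable_fun [set: nat] (standardize n).
Proof. by []. Qed.

HB.instance Definition _ n :=
  isMeasurableFun.Build _ _ _ _ (standardize n) (measurable_standardize n).

(* The library puts the binomial law on [nat]; the inclusion of [nat] in [R]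
   is part of the map [standardize n]. *)
Definition std_binomial (n : nat) : probability (measurableTypeR R) R :=
  distribution (binomial_prob n (2^-1 : R)) (standardize n).

Definition std_normal : probability (measurableTypeR R) R := normal_prob 0 1.

End laws.

Section zolotarev.
Context {R : realType}.

Definition F3 : set (R -> R) := [set f : R -> R |
  [/\ bounded_fun f,
      (forall x, derivable f x 1),
      (forall x, derivable (derive1 f) x 1),
      continuous (derive1 (derive1 f)) &
      forall x y, `|derive1 (derive1 f) x - derive1 (derive1 f) y| <= `|x - y|]].

Definition zolotarev3 (P Q : probability (measurableTypeR R) R) : \bar R :=
  ereal_sup [set `|\int[P]_x (f x)%:E - \int[Q]_x (f x)%:E|%E | f in F3].

End zolotarev.

Section zeta.
Context {R : realType}.

(* The Riemann zeta function on the positive half-line without 1: the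
   Euler-Maclaurin formula
     zeta(s) = lim_N (\sum_(1 <= k <= N) k^(-s) - N^(1-s) / (1-s)),
   whose right-hand side is analytic in Re s > 0, s <> 1, and reduces to the
   Dirichlet series when s > 1 (see [riemann_zeta_gt1]).  The value of this
   definition is not meaningful for s <= 0 or s = 1. *)
Definition riemann_zeta (s : R) : R :=
  limn (fun N : nat => \sum_(1 <= k < N.+1) k%:R `^ (- s)
                       - N%:R `^ (1 - s) / (1 - s)).

Lemma riemann_zeta_gt1 (s : R) : 1 < s ->
  riemann_zeta s = limn (fun N : nat => \sum_(1 <= k < N.+1) k%:R `^ (- s)).
Proof.
move=> s1.
have powR_N0 : (N%:R `^ (1 - s) / (1 - s) : R) @[N --> \oo] --> (0 : R).
  rewrite -[X in _ --> X](mul0r (1 - s)^-1); apply: cvgMl.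
  have -> : (fun N : nat => N%:R `^ (1 - s) : R) =
            (fun N : nat => (N%:R^-1 : R) `^ (s - 1)).
    by apply/funext => N; rewrite -powR_inv1// -powRrM mulN1r opprB.
  apply/cvgrPdist_lt => e e0; near=> N.
  have N0 : (0 < N%:R :> R) by rewrite ltr0n; near: N; exact: nbhs_infty_gt.
  rewrite sub0r normrN ger0_norm ?powR_ge0//.
  have -> : e = (e `^ (s - 1)^-1) `^ (s - 1).
    by rewrite -powRrM mulVf ?powRr1 ?(ltW e0)// subr_eq0 gt_eqF.
  rewrite gt0_ltr_powR ?subr_gt0 ?nnegrE ?invr_ge0 ?powR_ge0 ?ler0n//.
  rewrite invf_plt ?posrE ?powR_gt0//.
  by near: N; exact: nbhs_infty_gtr.
suff lim_iff (u v : nat -> R) : v @ \oo --> (0 : R) ->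
    limn (fun N => u N - v N) = limn u.
  exact: lim_iff.
move=> v0; rewrite /lim /lim_in; congr get; apply/funext => l /=.
apply/propext; split => [uvl | ul].
- have -> : u = (fun N => u N - v N + v N) by apply/funext => N; rewrite subrK.
  by rewrite -[l]addr0; apply: cvgD.
- by rewrite -[l]subr0; apply: cvgB.
Unshelve. all: by end_near. Qed.

End zeta.

Section bound.
Context {R : realType}.

Definition L (n : nat) : R :=
  6^-1 *
  if odd n then
    `|(2 * n%:R `^ (1 / 2) + n%:R `^ (- (1 / 2)) - n%:R `^ (- (3 / 2)))
        * b_half n n./2 - 4 / Num.sqrt (2 * pi)|
  else
    `|2 * n%:R `^ (1 / 2) * b_half n n./2 - 4 / Num.sqrt (2 * pi)|.

End bound.

(* Main.v *)
(** Lindeberg's method along the Gaussian semigroup [G_s f x = E f (x + s Z)].  With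
    [a = n ^ (-1/2)] and [T f x = (f (x + a) + f (x - a)) / 2], the two laws integrate
    [f] to [T^n f 0] and [G_1 f 0], so their difference telescopes into terms
    [T h - G_a h] with [h = G_(a sqrt k) f], [k < n].  Since [F t = h (x + t) + h (x - t)]
    is even and a function with derivative vanishing at 0 and nondecreasing second
    derivative is convex in [t ^ 2], a bound
    [|F'' t - F'' r| <= P'' t - P'' r] implies
    [|T h x - G_a h x| <= (E P (a |Z|) - P a) / 2], because [E Z^2 = 1].
    For [k = 0] the Lipschitz property of [f''] allows [P t = t^3 / 3]; for [k > 0]
    Stein's identity shows that the third derivative of [h] is Lipschitz with constant
    [E |Z| / (a sqrt k)], and [P] is a multiple of [t^4].  Summing, the terms
    [k ^ (-1/2)] produce [zeta (1/2)], with strict inequality since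
    [\sum_(k < n) k ^ (-1/2) - 2 sqrt n] increases to [zeta (1/2)].

    The lower bound tests with damped versions of [|x|^3 / 6], whose binomial moment
    is a telescoping sum; it also forces [L n -> 0], which identifies the limit of
    [sqrt m] times the central binomial probability, and two monotone sequences
    converging to it give the expansion of [L n]. *)
From HB Require Import structures.
Require Import Defs.
From mathcomp Require Import all_boot all_order all_algebra.
From mathcomp Require Import zify ring lra.
From mathcomp Require Import all_classical all_reals all_analysis.
From mathcomp Require Import measurable_realfun.

Set Implicit Arguments.
Unset Strict Implicit.
Unset Printing Implicit Defensive.

Import Order.TTheory GRing.Theory Num.Theory.
Import numFieldNormedType.Exports.

Local Open Scope classical_set_scope.
Local Open Scope ring_scope.

(** * Integration against the normal law through its density, and Gaussian convolution *)

Section gauss.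
Context {R : realType}.
Implicit Types (f : R -> R) (x y s t u : R).
Local Notation mu := (@lebesgue_measure R).
Local Notation phi := (@normal_pdf R 0 1).
Local Notation N := (@std_normal R).

(** The density [phi] and the Radon-Nikodym derivative of [N] have the same integral over every
    measurable set, hence agree almost everywhere. *)
Lemma ge0_integral_std_normal (f : R -> \bar R) :
  measurable_fun setT f -> (forall x, 0 <= f x)%E ->
  (\int[N]_x f x = \int[mu]_x (f x * (phi x)%:E))%E.
Proof.
move=> mf f0.
have dom : std_normal `<< mu := @normal_prob_dominates R 0 1.
have mrn : measurable_fun setT (Radon_Nikodym_SigmaFinite.f N mu).
  by apply: (measurable_int mu); exact: Radon_Nikodym_SigmaFinite.f_integrable.
have mphi : measurable_fun setT (fun x => (phi x)%:E).
  by apply/measurable_EFinP; exact: measurable_normal_pdf.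
rewrite -(Radon_Nikodym_SigmaFinite.change_of_variables dom)//=.
apply: ae_eq_integral => //.
- exact: emeasurable_funM.
- exact: emeasurable_funM.
- apply: ae_eqe_mul2l; apply: integral_ae_eq => //.
  + exact: Radon_Nikodym_SigmaFinite.f_integrable.
  + by move=> A AT mA; rewrite -Radon_Nikodym_SigmaFinite.f_integral.
Qed.

Lemma normal_peak_eq s : 0 < s -> normal_peak s = normal_peak 1 / s :> R.
Proof.
move=> s0; rewrite /normal_peak expr1n mul1r -mulrnAr sqrtrM ?sqr_ge0//.
by rewrite sqrtr_sqr gtr0_norm// invfM mulrC.
Qed.

Lemma normal_pdf_ne0 m s x : 0 < s ->
  normal_pdf m s x = normal_peak 1 / s * expR (- ((x - m) / s) ^+ 2 / 2) :> R.
Proof.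
move=> s0; rewrite normal_pdfE ?gt_eqF//= normal_peak_eq//; congr (_ * _).
rewrite /normal_fun; congr expR; rewrite expr_div_n -[s ^+ 2 *+ 2]mulr_natr.
by field; rewrite gt_eqF.
Qed.

Lemma phiE x : phi x = normal_peak 1 * expR (- x ^+ 2 / 2).
Proof. by rewrite normal_pdf_ne0// subr0 !divr1. Qed.

(** Substitution of [F z = m + s * z], whose constant derivative [s] cancels the factor [1 / s] of
    [normal_pdf m s]. *)
Lemma integral_affine_std_normal f m s : 0 < s -> continuous f ->
  (forall x, 0 <= f x) ->
  (\int[N]_z (f (m + s * z))%:E = \int[mu]_x (f x * normal_pdf m s x)%:E)%E.
Proof.
move=> s0 cf f0; pose F z := m + s * z.
have dF (z : R^o) : is_derive z 1 (F : R^o -> R^o) s.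
  by apply: is_derive_eq; rewrite /GRing.scale/=; ring.
have F'E : derive1 F = cst s.
  by apply/funext => z; rewrite derive1E; exact: derive_val.
have cF : continuous F.
  by move=> z; apply/differentiable_continuous/derivable1_diffP; exact: ex_derive.
have cG : continuous (fun x => f x * normal_pdf m s x).
  by move=> x; apply: cvgM; [exact: cf | apply: continuous_normal_pdf; rewrite gt_eqF].
have mfF : measurable_fun setT (fun z => (f (m + s * z))%:E).
  apply/measurable_EFinP; apply: continuous_measurable_fun => z.
  apply: (@continuous_comp _ _ _ F f); [exact: cF|exact: cf].
rewrite (ge0_integral_std_normal mfF); last by move=> z; rewrite lee_fin.
rewrite (@increasing_ge0_integration_by_substitutionT _ F (fun x => f x * normal_pdf m s x)).
- apply: eq_integral => z _.
  rewrite -EFinM -[RHS]/((f (F z) * normal_pdf m s (F z) * derive1 F z)%:E) F'E.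
  rewrite phiE normal_pdf_ne0// /F /cst (addrAC m) subrr add0r (mulrAC s) mulfV ?gt_eqF// mul1r.
  by congr EFin; field; rewrite gt_eqF.
- by move=> x y xy; rewrite /F ltrD2l ltr_pM2l.
- by rewrite F'E; move=> x; exact: cst_continuous.
- by rewrite F'E; exact: is_cvg_cst.
- by rewrite F'E; exact: is_cvg_cst.
- by move=> x; exact: ex_derive.
- apply: (cvg_comp _ (fun y => m + y) _ (cvg_addrl_Ny m)).
  rewrite (_ : *%R s = *%R^~ s); last by apply/funext => z; rewrite mulrC.
  apply: gt0_cvgMlNy => //; exact: cvg_id.
- apply: (cvg_comp _ (fun y => m + y) _ (cvg_addrl m)).
  rewrite (_ : *%R s = *%R^~ s); last by apply/funext => z; rewrite mulrC.
  apply: gt0_cvgMly => //; exact: cvg_id.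
- exact: cG.
- by move=> x; rewrite mulr_ge0// normal_pdf_ge0.
Qed.

(* Completing the square in [y]. *)
Lemma normal_pdf_conv (a b x y u : R) : 0 < a -> 0 < b ->
  let c := Num.sqrt (a ^+ 2 + b ^+ 2) in
  phi y * normal_pdf (x + a * y) b u =
  normal_pdf x c u * normal_pdf (a * (u - x) / c ^+ 2) (b / c) y.
Proof.
move=> a0 b0 c; have c0 : 0 < c by rewrite sqrtr_gt0 addr_gt0// exprn_gt0.
have c2 : c ^+ 2 = a ^+ 2 + b ^+ 2 by rewrite sqr_sqrtr// addr_ge0// sqr_ge0.
rewrite !normal_pdf_ne0 ?divr_gt0// mulrACA [RHS]mulrACA -!expRD; congr (_ * expR _).
  by field; rewrite !gt_eqF.
rewrite !expr_div_n c2 expr1n; field.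
by rewrite -c2 !gt_eqF// exprn_gt0.
Qed.

(** Tonelli's theorem moves the integral over [y] inside; by [normal_pdf_conv] the factor depending
    on [y] is then a probability density and integrates to [1]. *)
Lemma std_normal_convolution f (a b x : R) : 0 < a -> 0 < b -> continuous f ->
  (forall x, 0 <= f x) ->
  (\int[N]_y \int[N]_z (f (x + a * y + b * z))%:E =
   \int[N]_z (f (x + Num.sqrt (a ^+ 2 + b ^+ 2) * z))%:E)%E.
Proof.
move=> a0 b0 cf f0; set c := Num.sqrt _.
have c0 : 0 < c by rewrite sqrtr_gt0 addr_gt0// exprn_gt0.
have mf : measurable_fun setT f by exact: continuous_measurable_fun.
rewrite (integral_affine_std_normal x c0)//.
under eq_integral do rewrite integral_affine_std_normal//.
have pdf_shift y u : normal_pdf (x + a * y) b u = normal_pdf 0 b (u - (x + a * y)).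
  by rewrite !normal_pdf_ne0// subr0.
have mg : measurable_fun setT
    (fun yu : R * R => f yu.2 * normal_pdf (x + a * yu.1) b yu.2).
  apply: measurable_funM; first exact: (measurableT_comp mf).
  under eq_fun do rewrite pdf_shift.
  apply: (measurableT_comp (measurable_normal_pdf 0 b)).
  apply: measurable_funB => //; apply: measurable_funD => //.
  exact: measurable_funM.
have mh : measurable_fun setT
    (fun yu : R * R => (phi yu.1 * (f yu.2 * normal_pdf (x + a * yu.1) b yu.2))%:E).
  apply/measurable_EFinP; apply: measurable_funM => //.
  exact: (measurableT_comp (measurable_normal_pdf 0 1)).
have g0 y u : (0 <= (f u * normal_pdf (x + a * y) b u)%:E)%E.
  by rewrite lee_fin mulr_ge0// normal_pdf_ge0.
have mgy y : measurable_fun setT (fun u => (f u * normal_pdf (x + a * y) b u)%:E).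
  by apply/measurable_EFinP/measurable_funM => //; exact: measurable_normal_pdf.
rewrite ge0_integral_std_normal; last 2 first.
- apply: (@measurable_fun_fubini_tonelli_F _ _ _ _ _ mu
    (fun yu : R * R => (f yu.2 * normal_pdf (x + a * yu.1) b yu.2)%:E)).
  + exact/measurable_EFinP.
  + by move=> yu; exact: g0.
- by move=> y; apply: integral_ge0 => u _; exact: g0.
transitivity (\int[mu]_y \int[mu]_u (phi y * (f u * normal_pdf (x + a * y) b u))%:E)%E.
  apply: eq_integral => y _; rewrite muleC -ge0_integralZl//; first exact: mgy.
  by rewrite lee_fin normal_pdf_ge0.
apply: (etrans (@fubini_tonelli _ _ _ _ _ mu mu (fun yu : R * R =>
    (phi yu.1 * (f yu.2 * normal_pdf (x + a * yu.1) b yu.2))%:E) mh _)).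
  by move=> yu; rewrite lee_fin !mulr_ge0// normal_pdf_ge0.
apply: eq_integral => u _.
rewrite /=; under eq_integral do rewrite mulrCA normal_pdf_conv// -/c mulrA EFinM.
rewrite ge0_integralZl//.
- by rewrite integral_normal_pdf mule1.
- by apply/measurable_EFinP; exact: measurable_normal_pdf.
- by move=> y _; rewrite lee_fin normal_pdf_ge0.
- by rewrite lee_fin mulr_ge0// normal_pdf_ge0.
Qed.
End gauss.

(** * Tame functions: continuous, of polynomial growth, and integrable for the normal law *)

Definition tame {R : realType} (f : R -> R) :=
  continuous f /\ exists C k, forall x, `|f x| <= C * (1 + `|x|) ^+ k.

Definition normal_E {R : realType} (f : R -> R) : R :=
  Rintegral (@std_normal R) setT f.

Section tame.
Context {R : realType}.
Implicit Types (f g : R -> R) (x m s : R).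

Lemma tame_cts f : tame f -> continuous f. Proof. by case. Qed.

Lemma tame_measurable f : tame f -> measurable_fun setT f.
Proof. by case=> + _; exact: continuous_measurable_fun. Qed.

Lemma tame_bound f : tame f ->
  exists C k, 0 <= C /\ forall x, `|f x| <= C * (1 + `|x|) ^+ k.
Proof.
case=> _ [C [k Ck]]; exists C, k; split=> //.
by have := Ck 0; rewrite normr0 addr0 expr1n mulr1; apply: le_trans.
Qed.

Lemma growth_le1 x (j k : nat) : (j <= k)%N -> (1 + `|x|) ^+ j <= (1 + `|x|) ^+ k.
Proof. by move=> jk; apply: ler_weXn2l => //; rewrite lerDl. Qed.

Lemma tame_cst c : tame (fun=> c : R).
Proof.
split; first by move=> x; exact: cst_continuous.
by exists `|c|, 0%N => x; rewrite expr0 mulr1.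
Qed.

Lemma tame_id : tame (@idfun R).
Proof.
split; first by move=> x; exact: cvg_id.
by exists 1, 1%N => x; rewrite mul1r expr1 lerDr.
Qed.

Lemma tameD f g : tame f -> tame g -> tame (fun x => f x + g x).
Proof.
move=> tf tg; split.
  by move=> x; apply: cvgD; [exact: (tame_cts tf)|exact: (tame_cts tg)].
have [C [k [C0 Ck]]] := tame_bound tf; have [D [l [D0 Dl]]] := tame_bound tg.
exists (C + D), (k + l)%N => x; apply: le_trans (ler_normD _ _) _.
rewrite mulrDl lerD//.
  by apply: le_trans (Ck x) _; rewrite ler_wpM2l// growth_le1// leq_addr.
by apply: le_trans (Dl x) _; rewrite ler_wpM2l// growth_le1// leq_addl.
Qed.

Lemma tameM f g : tame f -> tame g -> tame (fun x => f x * g x).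
Proof.
move=> tf tg; split.
  by move=> x; apply: cvgM; [exact: (tame_cts tf)|exact: (tame_cts tg)].
have [C [k [C0 Ck]]] := tame_bound tf; have [D [l [D0 Dl]]] := tame_bound tg.
exists (C * D), (k + l)%N => x; rewrite normrM exprD mulrACA.
by apply: ler_pM.
Qed.

Lemma tameZ (c : R) f : tame f -> tame (fun x => c * f x).
Proof. by apply: tameM; exact: tame_cst. Qed.

Lemma tameN f : tame f -> tame (fun x => - f x).
Proof.
by move=> /(tameZ (-1)); rewrite (_ : (fun x => -1 * f x) = fun x => - f x)//;
  apply/funext => x; rewrite mulN1r.
Qed.

Lemma tameB f g : tame f -> tame g -> tame (fun x => f x - g x).
Proof. by move=> tf tg; apply: tameD => //; exact: tameN. Qed.

Lemma tame_abs f : tame f -> tame (fun x => `|f x|).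
Proof.
move=> tf; split.
  move=> x; apply: (@continuous_comp _ _ _ f (@Num.norm R R)); first exact: (tame_cts tf).
  exact: norm_continuous.
by have [C [k [C0 Ck]]] := tame_bound tf; exists C, k => x; rewrite normr_id.
Qed.

Lemma tameX f n : tame f -> tame (fun x => f x ^+ n).
Proof.
move=> tf; elim: n => [|n ih]; first exact: tame_cst.
rewrite (_ : (fun x => f x ^+ n.+1) = fun x => f x * f x ^+ n); first exact: tameM.
by apply/funext => x; rewrite exprS.
Qed.

Lemma tame_affine f m s : tame f -> tame (fun x => f (m + s * x)).
Proof.
move=> tf; split.
  move=> x; apply: (@continuous_comp _ _ _ (fun x => m + s * x) f).
    apply: cvgD; first exact: cvg_cst.
    by apply: cvgM; [exact: cvg_cst|exact: cvg_id].
  exact: (tame_cts tf).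
have [C [k [C0 Ck]]] := tame_bound tf.
exists (C * (1 + `|m| + `|s|) ^+ k), k => x; apply: le_trans (Ck _) _.
rewrite -mulrA ler_wpM2l// -exprMn lerXn2r ?nnegrE ?mulr_ge0 ?addr_ge0//.
have := ler_normD m (s * x); rewrite normrM => h.
have := mulr_ge0 (normr_ge0 m) (normr_ge0 x).
move: (normr_ge0 x) (normr_ge0 s) (normr_ge0 m) h.
by set X := `|x|; set S := `|s|; set M := `|m|; nra.
Qed.

Local Notation mu := (@lebesgue_measure R).
Local Notation phi := (@normal_pdf R 0 1).
Local Notation N := (@std_normal R).

(** Combines [t ^ k / k! <= expR t] at [t = 1 + |x|] with [|x| <= 1 + x ^ 2 / 4]. *)
Lemma growth_le_expR x k : (1 + `|x|) ^+ k <= k`!%:R * expR 2 * expR (x ^+ 2 / 4).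
Proof.
have h : (1 + `|x|) ^+ k <= k`!%:R * expR (1 + `|x|).
  case: k => [|k]; first by rewrite expr0 mul1r -expR0 ler_expR addr_ge0.
  have := @expR_ge1Dxn R (1 + `|x|) k (addr_ge0 ler01 (normr_ge0 x)).
  move=> h; rewrite [leRHS]mulrC -ler_pdivrMr ?ltr0n ?fact_gt0//.
  by apply: le_trans h; rewrite lerDr.
apply: le_trans h _; rewrite -mulrA ler_wpM2l// -expRD ler_expR.
have := sqr_ge0 (`|x| / 2 - 1); rewrite sqrrB expr_div_n real_normK ?num_real//.
by lra.
Qed.

(** Polynomial growth costs half of the Gaussian exponent [x ^ 2 / 2]; the other half remains for
    integrability and for decay at infinity. *)
Lemma tame_gauss_bound f : tame f ->
  exists C, 0 <= C /\ forall x, `|f x * phi x| <= C * expR (- x ^+ 2 / 4).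
Proof.
move=> /tame_bound[C [k [C0 Ck]]].
exists (C * (k`!%:R * expR 2) * normal_peak 1); split.
  by rewrite !mulr_ge0// ?expR_ge0// normal_peak_ge0.
move=> x; rewrite normrM (ger0_norm (normal_pdf_ge0 _ _ _)) phiE.
have -> : expR (- x ^+ 2 / 2) = (expR (x ^+ 2 / 4))^-1 * expR (- x ^+ 2 / 4) :> R.
  by rewrite -expRN -expRD; congr expR; field.
rewrite [leRHS](_ : _ = C * (k`!%:R * expR 2 * expR (x ^+ 2 / 4)) *
  (normal_peak 1 * ((expR (x ^+ 2 / 4))^-1 * expR (- x ^+ 2 / 4)))); last first.
  by field; rewrite gt_eqF ?expR_gt0.
rewrite ler_wpM2r ?mulr_ge0 ?normal_peak_ge0 ?invr_ge0 ?expR_ge0//.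
by apply: le_trans (Ck x) _; rewrite ler_wpM2l// growth_le_expR.
Qed.

(** Up to a constant factor this is the normal density of variance [2]. *)
Lemma integrable_expR_sqr4 :
  mu.-integrable setT (fun x => (expR (- x ^+ 2 / 4))%:E).
Proof.
have s0 : 0 < Num.sqrt 2 :> R by rewrite sqrtr_gt0.
have -> : (fun x : R => (expR (- x ^+ 2 / 4))%:E) =
    (fun x => (Num.sqrt 2 / normal_peak 1)%:E * (normal_pdf 0 (Num.sqrt 2) x)%:E)%E.
  apply/funext => x; rewrite -EFinM normal_pdf_ne0// subr0 expr_div_n sqr_sqrtr//.
  have := @normal_peak_gt0 R 1 (oner_neq0 _) => p0.
  congr EFin; rewrite (_ : - (x ^+ 2 / 2) / 2 = - x ^+ 2 / 4); last by field.
  by field; rewrite !gt_eqF.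
exact/integrableZl/integrable_normal_pdf.
Qed.

Lemma integrable_tame_phi f : tame f -> mu.-integrable setT (EFin \o (fun x => f x * phi x)).
Proof.
move=> tf; have [C [C0 hC]] := tame_gauss_bound tf.
apply: (le_integrable measurableT _ _ (integrableZl measurableT C integrable_expR_sqr4)).
- apply/measurable_EFinP/measurable_funM; first exact: tame_measurable.
  exact: measurable_normal_pdf.
- move=> x _; rewrite /= lee_fin [leRHS]ger0_norm//.
  by rewrite mulr_ge0// expR_ge0.
Qed.

Lemma integrable_tame f : tame f -> N.-integrable setT (EFin \o f).
Proof.
move=> tf; apply/integrableP; split; first by apply/measurable_EFinP; exact: tame_measurable.
rewrite ge0_integral_std_normal//; last first.
  by apply/measurable_EFinP/measurableT_comp => //; exact: (tame_measurable tf).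
have /integrableP[_] := integrable_tame_phi (tame_abs tf).
by under eq_integral do rewrite /= ger0_norm ?mulr_ge0 ?normal_pdf_ge0// EFinM.
Qed.

Lemma EFin_normal_E f : tame f -> (\int[N]_x (f x)%:E)%E = (normal_E f)%:E.
Proof.
by move=> tf; rewrite /normal_E /Rintegral fineK//; exact/integrable_fin_num/integrable_tame.
Qed.

Lemma eq_normal_E f g : f =1 g -> normal_E f = normal_E g.
Proof. by move=> fg; rewrite (funext fg). Qed.

Lemma normal_E_cst c : normal_E (fun=> c : R) = c.
Proof. rewrite /normal_E Rintegral_cst//.
by rewrite [X in fine X](@probability_setT _ _ _ N) mulr1. Qed.

Lemma normal_ED f g : tame f -> tame g ->
  normal_E (fun x => f x + g x) = normal_E f + normal_E g.
Proof. by move=> tf tg; apply: RintegralD => //; exact: integrable_tame. Qed.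

Lemma normal_EB f g : tame f -> tame g ->
  normal_E (fun x => f x - g x) = normal_E f - normal_E g.
Proof. by move=> tf tg; apply: RintegralB => //; exact: integrable_tame. Qed.

Lemma normal_EZ c f : tame f -> normal_E (fun x => c * f x) = c * normal_E f.
Proof. by move=> tf; apply: RintegralZl => //; exact: integrable_tame. Qed.

Lemma le_normal_E f g : tame f -> tame g -> (forall x, f x <= g x) ->
  normal_E f <= normal_E g.
Proof. by move=> tf tg fg; apply: le_Rintegral => //; exact: integrable_tame. Qed.

Lemma normr_normal_E f : tame f -> `|normal_E f| <= normal_E (fun x => `|f x|).
Proof. by move=> tf; apply: le_normr_Rintegral => //; exact: integrable_tame. Qed.

Lemma ge0_normal_E_phi f : tame f -> (forall x, 0 <= f x) ->
  normal_E f = \int[mu]_x (f x * phi x).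
Proof.
move=> tf f0; rewrite /normal_E /Rintegral ge0_integral_std_normal//.
by apply/measurable_EFinP; exact: tame_measurable.
Qed.

(* [f = `|f| - (`|f| - f)] reduces to the nonnegative case. *)
Lemma normal_E_phi f : tame f -> normal_E f = \int[mu]_x (f x * phi x).
Proof.
move=> tf; have tg := tameB (tame_abs tf) tf.
rewrite (@eq_normal_E f (fun x => `|f x| - (`|f x| - f x))); last by move=> x; ring.
rewrite normal_EB//; last exact: tame_abs.
rewrite !ge0_normal_E_phi//; [|by move=> x; rewrite subr_ge0 ler_norm|exact: tame_abs].
rewrite -RintegralB//; [|exact: (integrable_tame_phi (tame_abs tf))|exact: integrable_tame_phi].
by apply: eq_Rintegral => x _; ring.
Qed.

End tame.

(** * Stein's identity and the moments of the normal law *)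

Section stein.
Context {R : realType}.
Implicit Types (f g u v : R -> R) (x m s : R).
Local Notation mu := (@lebesgue_measure R).
Local Notation phi := (@normal_pdf R 0 1).
Local Notation N := (@std_normal R).

Lemma is_derive_continuous f g : (forall x, is_derive x 1 f (g x)) -> continuous f.
Proof.
by move=> df x; apply/differentiable_continuous/derivable1_diffP; exact: ex_derive.
Qed.

Lemma sqrt_2pi_gt0 : 0 < Num.sqrt (2 * pi) :> R.
Proof. by rewrite sqrtr_gt0 mulr_gt0// pi_gt0. Qed.

Lemma is_derive_phi x : is_derive x 1 phi (- x * phi x).
Proof.
rewrite (_ : phi = fun x => normal_peak 1 * expR (- x ^+ 2 / 2)); last first.
  by apply/funext => y; rewrite phiE.
by apply: is_derive_eq; rewrite /GRing.scale/=; field.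
Qed.

Lemma expR_sqr4_cvg0 : expR (- (n%:R : R) ^+ 2 / 4) @[n --> \oo] --> (0 : R).
Proof.
have h0 : (4 * n.+1%:R^-1 : R) @[n --> \oo] --> (0 : R).
  rewrite -[X in _ --> X](mulr0 4); apply: cvgM; first exact: cvg_cst.
  exact: cvg_harmonic.
apply: (squeeze_cvgr _ (cvg_cst (0 : R)) h0).
near=> n; rewrite expR_ge0 /=.
rewrite mulNr expRN -[4 * _]invrK invfM invrK lef_pV2 ?posrE ?expR_gt0 ?mulr_gt0 ?ltr0n ?invr_gt0//.
apply: le_trans (expR_ge1Dx _).
rewrite -[n.+1%:R]natr1; move: (n%:R : R) => t.
have := sqr_ge0 (t - 1 / 2); nra.
Unshelve. all: by end_near. Qed.

(** The condition [e ^+ 2 = 1] treats both ends of the line, [e = 1] and [e = -1], at once. *)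
Lemma tame_phi_cvg0 f (e : R) : e ^+ 2 = 1 -> tame f ->
  f (e * n%:R) * phi (e * n%:R) @[n --> \oo] --> (0 : R).
Proof.
move=> e2 tf; have [C [C0 hC]] := tame_gauss_bound tf.
have h n : `|f (e * n%:R) * phi (e * n%:R)| <= C * expR (- n%:R ^+ 2 / 4).
  by have := hC (e * n%:R); rewrite exprMn e2 mul1r.
have h0 : C * expR (- (n%:R : R) ^+ 2 / 4) @[n --> \oo] --> (0 : R).
  rewrite -[X in _ --> X](mulr0 C); apply: cvgM; first exact: cvg_cst.
  exact: expR_sqr4_cvg0.
have h0' : - (C * expR (- (n%:R : R) ^+ 2 / 4)) @[n --> \oo] --> (0 : R).
  by rewrite -[X in _ --> X]oppr0; exact: cvgN.
apply: (squeeze_cvgr _ h0' h0); near=> n.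
by rewrite -ler_norml.
Unshelve. all: by end_near. Qed.

(** The fundamental theorem of calculus on [[-n, n]], followed by dominated convergence with
    dominating function [|g| * phi]. *)
Lemma FTC_tame_phi (G g : R -> R) :
  (forall x, is_derive x 1 G (g x * phi x)) -> tame g ->
  (G n%:R - G (- n%:R)) @[n --> \oo] --> normal_E g.
Proof.
move=> dG tg.
have ctg : continuous (fun x => g x * phi x).
  by move=> x; apply: cvgM; [exact: (tame_cts tg)|exact: continuous_normal_pdf].
have cG : continuous G.
  exact: (is_derive_continuous dG).
pose D n : set R := `[- n%:R, n%:R]%classic.
have FTC (n : nat) : (0 < n)%N ->
    (\int[mu]_x ((g x * phi x) * \1_(D n) x)%:E = (G n%:R - G (- n%:R))%:E)%E.
  move=> n0; rewrite EFinB -(@continuous_FTC2 _ (fun x => g x * phi x)).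
  - rewrite [RHS]integral_mkcond; apply: eq_integral => x _.
    by rewrite patchE indicE; case: ifP => _; rewrite ?mulr1 ?mulr0.
  - by have : 0 < n%:R :> R by [rewrite ltr0n]; lra.
  - exact: continuous_subspaceT.
  - split; first by move=> x _; exact: ex_derive.
    + by apply: cvg_at_right_filter; exact: cG.
    + by apply: cvg_at_left_filter; exact: cG.
  - by move=> x _; rewrite derive1E; exact: derive_val.
have mg : measurable_fun setT (fun x => g x * phi x) by exact: continuous_measurable_fun.
have [] := @dominated_convergence _ _ _ mu setT measurableT
  (fun n x => (g x * phi x * \1_(D n) x)%:E) (fun x => (g x * phi x)%:E)
  (fun x => (`|g x| * phi x)%:E).
- move=> n; apply/measurable_EFinP/measurable_funM => //.
  by apply: measurable_indic; exact: measurable_itv.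
- by apply/measurable_EFinP.
- apply: aeW => x _; apply/fine_cvgP; split; first exact: nearW.
  apply: cvg_near_cst; near=> n.
  rewrite /= indicE mem_set ?mulr1// /D /= in_itv/= -ler_norml.
  by near: n; exact: nbhs_infty_ger.
- exact: (integrable_tame_phi (tame_abs tg)).
- apply: aeW => x n _; rewrite lee_fin !normrM (ger0_norm (normal_pdf_ge0 _ _ _)).
  rewrite ler_piMr ?mulr_ge0 ?normal_pdf_ge0// indicE.
  by case: (_ \in _); rewrite ?normr1 ?normr0.
have fin : (\int[mu]_x (g x * phi x)%:E)%E \is a fin_num.
  exact/integrable_fin_num/integrable_tame_phi.
move=> _ _; rewrite -(fineK fin) => /fine_cvgP[_ h].
rewrite normal_E_phi//; apply: cvg_trans h; apply: near_eq_cvg; near=> n.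
by rewrite /= FTC//; near: n; exact: nbhs_infty_gt.
Unshelve. all: by end_near. Qed.

(** The function [u * phi] has derivative [(v - u * z) * phi] and vanishes at both ends of the
    line. *)
Lemma stein u v : (forall x, is_derive x 1 u (v x)) -> tame u -> tame v ->
  normal_E v = normal_E (fun z => u z * z).
Proof.
move=> du tu tv.
have tuz : tame (fun z => u z * z) by apply: tameM => //; exact: tame_id.
apply/eqP; rewrite -subr_eq0 -normal_EB//; apply/eqP.
have dG x : is_derive x 1 (fun x => u x * phi x) ((v x - u x * x) * phi x).
  have := du x; have := is_derive_phi x => dp dx.
  by apply: is_derive_eq; rewrite /GRing.scale/=; ring.
have h1 := FTC_tame_phi dG (tameB tv tuz).
have h2 : u (1 * n%:R) * phi (1 * n%:R) - u (-1 * n%:R) * phi (-1 * n%:R) @[n --> \oo] --> (0 - 0 : R).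
  by apply: cvgB; apply: tame_phi_cvg0; rewrite ?sqrrN ?expr1n.
rewrite -[RHS](subr0 (0 : R)); apply: (cvg_unique _ h1 _) => //.
by move: h2; under eq_fun do rewrite mul1r mulN1r.
Qed.

Lemma normal_E_sqr : normal_E (fun z : R => z ^+ 2) = 1.
Proof.
have := @stein id (fun=> 1) _ (@tame_id R) (tame_cst 1).
rewrite normal_E_cst => -> //.
Qed.

Lemma normal_E_pow4 : normal_E (fun z : R => z ^+ 4) = 3.
Proof.
have t2 : tame (fun z : R => z ^+ 2) by apply: tameX; exact: tame_id.
have t3 : tame (fun z : R => z ^+ 3) by apply: tameX; exact: tame_id.
have <- : normal_E (fun z => 3 * z ^+ 2 : R) = 3.
  by rewrite normal_EZ// normal_E_sqr mulr1.
apply: esym; apply: etrans (@stein (fun z => z ^+ 3) (fun z => 3 * z ^+ 2) _ t3 (tameZ 3 t2)) _.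
- by move=> z; apply: is_derive_eq; rewrite /GRing.scale/=; ring.
- by apply: eq_normal_E => z; rewrite -exprSr.
Qed.

Lemma normal_pdf00 : phi 0 = (Num.sqrt (2 * pi))^-1.
Proof. by rewrite phiE expr0n/= oppr0 mul0r expR0 mulr1 /normal_peak expr1n mul1r mulr_natl. Qed.

Lemma tame_phi_cvgy f : tame f -> f x * phi x @[x --> +oo] --> (0 : R).
Proof.
move=> tf; have [C [C0 hC]] := tame_gauss_bound tf.
have h0 : C * expR 1 * expR (- (x : R)) @[x --> +oo] --> (0 : R).
  rewrite -[X in _ --> X](mulr0 (C * expR 1)); apply: cvgM; first exact: cvg_cst.
  exact: cvgr_expR.
have h x : `|f x * phi x| <= C * expR 1 * expR (- x).
  apply: le_trans (hC x) _; rewrite -mulrA ler_wpM2l// -expRD ler_expR.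
  by have := sqr_ge0 (x / 2 - 1); nra.
have h0' : - (C * expR 1 * expR (- (x : R))) @[x --> +oo] --> (0 : R).
  by rewrite -[X in _ --> X]oppr0; exact: cvgN.
apply: (squeeze_cvgr _ h0' h0); near=> n.
by rewrite -ler_norml.
Unshelve. all: by end_near. Qed.

(** Evenness gives twice the integral over the half-line, where [p * phi] is a primitive vanishing
    at infinity. There [h] is a formula for [g] free of absolute values. *)
Lemma normal_E_even g h p : tame g -> (forall x, 0 <= g x) -> (forall x, g (- x) = g x) ->
  continuous h -> (forall x, 0 <= x -> g x = h x) ->
  tame p -> (forall x, is_derive x 1 (fun x => p x * phi x) (h x * phi x)) ->
  normal_E g = - 2 * p 0 / Num.sqrt (2 * pi).
Proof.
move=> tg g0 ge ch gh tp dp.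
have cgp : continuous (fun x => g x * phi x).
  by move=> x; apply: cvgM; [exact: (tame_cts tg)|exact: continuous_normal_pdf].
have chp : continuous (fun x => h x * phi x).
  by move=> x; apply: cvgM; [exact: ch|exact: continuous_normal_pdf].
rewrite normal_E_phi// /Rintegral ge0_symfun_integralT//; last 2 first.
- by move=> x; rewrite mulr_ge0// normal_pdf_ge0.
- by move=> x /=; rewrite ge !phiE sqrrN.
have -> : (\int[mu]_(x in [set x | (0 <= x)%R]) (g x * phi x)%:E = (0 : R)%:E - (p 0 * phi 0)%:E)%E.
  rewrite -(@ge0_continuous_FTC2y _ (fun x => h x * phi x) (fun x => p x * phi x)).
  - rewrite set_itvcy; apply: eq_integral => x; rewrite inE/= => x0.
    by rewrite gh.
  - by move=> x x0; rewrite -gh// mulr_ge0// normal_pdf_ge0.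
  - exact: continuous_subspaceT.
  - exact: tame_phi_cvgy.
  - by move=> x _; exact: ex_derive.
  - apply: (@cvg_at_right_filter _ _ (fun x => p x * phi x)).
    exact: (is_derive_continuous dp).
  - by move=> x _; rewrite derive1E; exact: derive_val.
by rewrite /= normal_pdf00; field; rewrite gt_eqF ?sqrt_2pi_gt0.
Qed.

Lemma normal_E_abs : normal_E (fun z : R => `|z|) = 2 / Num.sqrt (2 * pi).
Proof.
apply: etrans (@normal_E_even _ id (fun=> -1) _ _ _ _ _ _ _) _;
  last by field; rewrite gt_eqF ?sqrt_2pi_gt0.
- by apply: tame_abs; exact: tame_id.
- by [].
- by move=> x; rewrite normrN.
- by move=> x; exact: cvg_id.
- by move=> x /ger0_norm.
- exact: tame_cst.
- move=> x; have := is_derive_phi x => dp.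
  by apply: is_derive_eq; rewrite /GRing.scale/=; ring.
Qed.

Lemma normal_E_abs3 : normal_E (fun z : R => `|z| ^+ 3) = 4 / Num.sqrt (2 * pi).
Proof.
have t2 : tame (fun z : R => z ^+ 2) by apply: tameX; exact: tame_id.
apply: etrans (@normal_E_even _ (fun x => x ^+ 3) (fun x => - (x ^+ 2 + 2)) _ _ _ _ _ _ _) _;
  last by field; rewrite gt_eqF ?sqrt_2pi_gt0.
- by apply/tameX/tame_abs; exact: tame_id.
- by move=> x; rewrite exprn_ge0.
- by move=> x; rewrite normrN.
- exact: exprn_continuous.
- by move=> x /ger0_norm ->.
- by apply/tameN/tameD => //; exact: tame_cst.
- move=> x; have := is_derive_phi x => dp.
  by apply: is_derive_eq; rewrite /GRing.scale/=; ring.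
Qed.

End stein.

(** * Mean value estimates, convexity in [t ^ 2], and differentiation under the expectation *)

Section calculus.
Context {R : realType}.
Implicit Types (f df : R -> R) (x y a b h t r : R).

Lemma mean_value f df a b : (forall x, is_derive x 1 f (df x)) -> a <= b ->
  exists2 c, a <= c <= b & f b - f a = df c * (b - a).
Proof.
move=> dfP ab; have [] := @MVT_segment R f df a b ab.
  exact/continuous_subspaceT/(is_derive_continuous dfP).
by move=> c; rewrite in_itv/= => cab cE; exists c.
Qed.

Lemma mean_value_abs f df a b : (forall x, is_derive x 1 f (df x)) ->
  exists2 c, `|c - a| <= `|b - a| & f b - f a = df c * (b - a).
Proof.
move=> dfP; have [ab|/ltW ba] := leP a b.
  have [c /andP[ac cb] cE] := mean_value dfP ab.
  by exists c => //; rewrite !ger0_norm ?subr_ge0// lerD2r.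
have [c /andP[bc ca] cE] := mean_value dfP ba.
exists c; last by rewrite -opprB cE; ring.
by rewrite !ler0_norm ?subr_le0// lerN2 lerD2r.
Qed.

Lemma is_derive_homo f df a b : (forall x, is_derive x 1 f (df x)) ->
  a <= b -> (forall x, a <= x <= b -> 0 <= df x) -> f a <= f b.
Proof.
move=> dfP ab df0; rewrite -subr_ge0; have [c cab ->] := mean_value dfP ab.
by rewrite mulr_ge0 ?subr_ge0// df0.
Qed.

Lemma taylor1 f df a h B : (forall x, is_derive x 1 f (df x)) ->
  (forall x, `|x - a| <= `|h| -> `|df x - df a| <= B) ->
  `|f (a + h) - f a - h * df a| <= `|h| * B.
Proof.
move=> dfP hB; have [c] := mean_value_abs a (a + h) dfP.
rewrite addrAC subrr add0r => ch ->.
rewrite mulrC -mulrBr normrM ler_wpM2l//; exact: hB.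
Qed.

(** A quadratic remainder bound is preserved by integration, so this criterion is the one that
    applies to expectations. *)
Lemma is_derive_quadratic f x d C : 
  (forall h, `|h| <= 1 -> `|f (x + h) - f x - h * d| <= h ^+ 2 * C) ->
  is_derive x 1 f d.
Proof.
move=> H.
suff cv : h^-1 *: (f (h *: 1 + x) - f x) @[h --> (0 : R)^'] --> d.
  by apply: DeriveDef; [apply/cvg_ex; exists d | exact: cvg_lim].
apply/cvgrPdist_le => e e0.
have C1 : 0 < `|C| + 1 by rewrite ltr_wpDl.
near=> h.
have h0 : h != 0 by near: h; exact: nbhs_dnbhs_neq.
have h1 : `|h| <= 1 by near: h; apply: dnbhs0_le.
have h2 : `|h| <= e / (`|C| + 1) by near: h; apply: dnbhs0_le; exact: divr_gt0.
have := H h h1; rewrite /GRing.scale/= mulr1 (addrC h x) => Hh.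
have -> : d - h^-1 * (f (x + h) - f x) = - h^-1 * (f (x + h) - f x - h * d).
  by field.
rewrite normrM normrN normfV mulrC ler_pdivrMr ?normr_gt0//.
apply: le_trans Hh _; rewrite -(real_normK (num_real h)) expr2 -mulrA mulrC ler_wpM2r//.
apply: le_trans (_ : `|h| * (`|C| + 1) <= _).
  by rewrite ler_wpM2l//; have := ler_norm C; lra.
by rewrite -ler_pdivlMr.
Unshelve. all: by end_near. Qed.

(* [H' r / r] is nondecreasing, so that [H] is convex as a function of [t ^ 2]. *)
Lemma even_convex (H H1 H2 : R -> R) a t :
  (forall x, is_derive x 1 H (H1 x)) -> (forall x, is_derive x 1 H1 (H2 x)) ->
  H1 0 = 0 -> (forall r t, 0 <= r -> r <= t -> H2 r <= H2 t) ->
  0 < a -> 0 <= t -> H1 a / (2 * a) * (t ^+ 2 - a ^+ 2) <= H t - H a.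
Proof.
move=> dH dH1 H10 mono a0 t0.
(* The increments of [H1] over [[0, r]] and [[r, s]] are governed by [H2] at ordered points
   [c1 <= c2]. *)
have slope r s : 0 <= r -> r <= s -> H1 r * s <= H1 s * r.
  move=> r0 rs; have [c1 /andP[c10 c1r]] := mean_value dH1 r0.
  have [c2 /andP[c2r c2s]] := mean_value dH1 rs.
  rewrite H10 !subr0 => e2 e1.
  have c12 := mono _ _ c10 (le_trans c1r c2r).
  have -> : H1 s = H2 c1 * r + H2 c2 * (s - r) by rewrite -e1 -e2; ring.
  rewrite e1; rewrite -subr_ge0.
  have -> : (H2 c1 * r + H2 c2 * (s - r)) * r - H2 c1 * r * s =
    (H2 c2 - H2 c1) * ((s - r) * r) by ring.
  by rewrite !mulr_ge0// subr_ge0.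
(* [c] is the slope at [a] of [H] as a function of the square. Removing [c * x ^ 2] leaves a
   function that decreases up to [a] and increases afterwards. *)
pose c := H1 a / (2 * a).
have dD x : is_derive x 1 (fun x => H x - c * x ^+ 2) (H1 x - c * (2 * x)).
  by have := dH x => dHx; apply: is_derive_eq; rewrite /GRing.scale/=; ring.
have D1E x : H1 x - c * (2 * x) = (H1 x * a - H1 a * x) / a.
  by rewrite /c; field; rewrite gt_eqF.
rewrite -/c; have [ta|/ltW at_] := leP t a.
  have [x /andP[tx xa]] := mean_value dD ta.
  rewrite D1E => E.
  suff : (H1 x * a - H1 a * x) / a * (a - t) <= 0 by rewrite -E; lra.
  rewrite mulr_le0_ge0 ?subr_ge0// pmulr_lle0 ?invr_gt0// subr_le0.
  by apply: slope => //; exact: le_trans tx.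
have [x /andP[ax xt]] := mean_value dD at_.
rewrite D1E => E.
suff : 0 <= (H1 x * a - H1 a * x) / a * (t - a) by rewrite -E; lra.
rewrite mulr_ge0 ?subr_ge0// divr_ge0 ?(ltW a0)// subr_ge0.
by apply: slope => //; exact: ltW.
Qed.

Lemma tame_primitive f df : (forall x, is_derive x 1 f (df x)) -> tame df -> tame f.
Proof.
move=> dfP /tame_bound[C [k [C0 Ck]]]; split; first exact: (is_derive_continuous dfP).
exists (`|f 0| + C), k.+1 => x.
have [c] := mean_value_abs 0 x dfP; rewrite !subr0 => cx E.
have {E} -> : f x = f 0 + df c * x by rewrite -E; ring.
apply: le_trans (ler_normD _ _) _; rewrite mulrDl lerD//.
  by rewrite ler_peMr// exprn_ege1// lerDl.
rewrite normrM exprSr mulrA ler_pM ?lerDr//.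
apply: le_trans (Ck c) _; rewrite ler_wpM2l// lerXn2r ?nnegrE ?addr_ge0//.
by rewrite lerD2l.
Qed.

Lemma tame_lipschitz f : (forall x y, `|f x - f y| <= `|x - y|) -> tame f.
Proof.
move=> lf; split.
  move=> x; apply/cvgrPdist_lt => e e0; near=> y.
  apply: le_lt_trans (lf _ _) _; near: y.
  exact: (nbhsx_ballx x e e0).
exists (`|f 0| + 1), 1%N => x; rewrite expr1.
have := lf x 0; rewrite subr0 => h.
have := ler_normD (f x - f 0) (f 0); rewrite subrK => h'.
have := mulr_ge0 (normr_ge0 (f 0)) (normr_ge0 x).
by move: h h' (normr_ge0 x); move: `|x| `|f 0| `|f x - f 0| `|f x| => *; nra.
Unshelve. all: by end_near. Qed.

(** Both sides split at [0] into the same two half-line integrals, which the reflection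
    exchanges. *)
Lemma ge0_integralT_oppr f : (forall x, 0 <= f x) -> continuous f ->
  (\int[lebesgue_measure]_x (f (- x))%:E = \int[lebesgue_measure]_x (f x)%:E)%E.
Proof.
have split_half (g : R -> R) : (forall x, 0 <= g x) -> continuous g ->
  (\int[lebesgue_measure]_x (g x)%:E =
   \int[lebesgue_measure]_(x in `[0%R, +oo[) (g x)%:E +
   \int[lebesgue_measure]_(x in `[0%R, +oo[) (g (- x))%:E)%E.
  move=> g0 cg.
  have mg : measurable_fun [set: R] g by exact: continuous_measurable_fun.
  rewrite -{1}(setUv (`[0%R, +oo[%classic : set R)) ge0_integral_setU//=; last 4 first.
  - exact: measurableC.
  - by apply/measurable_EFinP; rewrite setUv.
  - by move=> x _; rewrite lee_fin.
  - exact/disj_setPCl.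
  congr (_ + _)%E; rewrite setCitvr.
  rewrite integral_itv_bndo_bndc; last exact/measurable_EFinP/measurable_funTS.
  rewrite -{1}oppr0 ge0_integration_by_substitutionNy//.
  exact: continuous_subspaceT.
move=> f0 cf; rewrite split_half//; last first.
  by move=> x; apply: (@continuous_comp _ _ _ -%R f); [exact: oppr_continuous|exact: cf].
rewrite [RHS]split_half// addeC; congr (_ + _)%E.
by apply: eq_integral => x _; rewrite opprK.
Qed.

Lemma normal_E_oppr f : tame f -> normal_E (fun z => f (- z)) = normal_E f.
Proof.
have pe x : normal_pdf 0 1 (- x) = normal_pdf 0 1 x by rewrite !phiE sqrrN.
have ge0 (g : R -> R) : tame g -> (forall x, 0 <= g x) ->
    normal_E (fun z => g (- z)) = normal_E g.
  move=> tg g0; have tg' : tame (fun z => g (- z)).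
    have := tame_affine 0 (-1) tg.
    by under eq_fun do rewrite add0r mulN1r.
  rewrite !normal_E_phi// /Rintegral.
  rewrite -(@ge0_integralT_oppr (fun x => g x * normal_pdf 0 1 x)).
  - by under [in RHS]eq_integral do rewrite pe.
  - by move=> x; rewrite mulr_ge0// normal_pdf_ge0.
  - by move=> x; apply: cvgM; [exact: (tame_cts tg)|exact: continuous_normal_pdf].
move=> tf; have tg := tameB (tame_abs tf) tf; have ta := tame_abs tf.
have tN (g : R -> R) : tame g -> tame (fun z => g (- z)).
  by move=> /(tame_affine 0 (-1)); under eq_fun do rewrite add0r mulN1r.
have E (g : R -> R) : tame g ->
    normal_E g = normal_E (fun x => `|g x|) - normal_E (fun x => `|g x| - g x).
  move=> tg'; rewrite -normal_EB; first by apply: eq_normal_E => x; ring.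
  - exact: tame_abs.
  - by apply: tameB => //; exact: tame_abs.
rewrite E; last exact: tN.
rewrite (ge0 (fun x => `|f x|))// (ge0 (fun x => `|f x| - f x))// -?E//.
by move=> x; rewrite subr_ge0 ler_norm.
Qed.

(** The pointwise remainder bound integrates to [h ^ 2 * normal_E w], which [is_derive_quadratic]
    accepts. *)
Lemma is_derive_normal_E (k : R -> R -> R) (k' w : R -> R) x :
  (forall y, tame (k y)) -> tame k' -> tame w ->
  (forall h z, `|h| <= 1 -> `|k (x + h) z - k x z - h * k' z| <= h ^+ 2 * w z) ->
  is_derive x 1 (fun y => normal_E (k y)) (normal_E k').
Proof.
move=> tk tk' tw H; apply: (@is_derive_quadratic _ _ _ (normal_E w)) => h h1.
have tkd : tame (fun z => k (x + h) z - k x z) by exact: tameB.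
have thk : tame (fun z => h * k' z) by exact: tameZ.
rewrite -normal_EB// -normal_EZ// -normal_EB// -normal_EZ//.
apply: le_trans (normr_normal_E _) _; first exact: tameB.
apply: le_normal_E.
- by apply: tame_abs; exact: tameB.
- exact: tameZ.
- by move=> z; exact: H.
Qed.

End calculus.

(** * The Gaussian semigroup and the comparison of one walk step with one Gaussian step *)

Definition heat {R : realType} (s : R) (f : R -> R) (x : R) : R :=
  normal_E (fun z => f (x + s * z)).

Section heat.
Context {R : realType}.
Implicit Types (f : R -> R) (x y a b h t r s : R).

Lemma tame_ext f g : f =1 g -> tame f -> tame g.
Proof. by move=> /funext ->. Qed.

Lemma tame_comp_abs f : tame f -> tame (fun z => f `|z|).
Proof.
case=> cf [C [k Ck]]; split; last by exists C, k => z; rewrite -[`|z| in leRHS]normr_id.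
move=> x; apply: (@continuous_comp _ _ _ (@Num.norm R R) f); last exact: cf.
exact: norm_continuous.
Qed.

Lemma heat_oppr s f x : tame f -> normal_E (fun z => f (x - s * z)) = heat s f x.
Proof.
move=> tf; rewrite /heat -(normal_E_oppr (tame_affine x s tf)).
by apply: eq_normal_E => z; rewrite mulrN.
Qed.

(** The convolution formula concerns nonnegative functions, so [f] is first raised by [K], a
    constant that passes through [heat]. *)
Lemma heat_semigroup a b f K x : 0 < a -> 0 < b -> tame f -> tame (heat b f) ->
  (forall x, - K <= f x) ->
  heat a (heat b f) x = heat (Num.sqrt (a ^+ 2 + b ^+ 2)) f x.
Proof.
move=> a0 b0 tf tG fK; pose g x := f x + K.
have tg : tame g by apply: tameD => //; exact: tame_cst.
have heat_g s y : heat s g y = heat s f y + K.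
  rewrite /heat /g normal_ED; [|exact: tame_affine|exact: tame_cst].
  by rewrite normal_E_cst.
have : heat a (heat b g) x = heat (Num.sqrt (a ^+ 2 + b ^+ 2)) g x.
  rewrite {1 3}/heat /normal_E /Rintegral -std_normal_convolution//.
  - by congr fine; apply: eq_integral => y _; rewrite EFin_normal_E//; exact: tame_affine.
  - exact: tame_cts.
  - by move=> y; rewrite /g -lerBlDr sub0r.
rewrite heat_g {1}/heat.
rewrite (@eq_normal_E _ _ (fun z => heat b f (x + a * z) + K)) => [|z]; last exact: heat_g.
rewrite normal_ED; [|exact: tame_affine|exact: tame_cst].
by rewrite normal_E_cst => /addIr.
Qed.

Section step.
Variables (h h1 h2 : R -> R).
Hypothesis dh : forall x, is_derive x 1 h (h1 x).
Hypothesis dh1 : forall x, is_derive x 1 h1 (h2 x).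
Hypothesis tame_h : tame h.

(** By the last hypothesis both [P + F] and [P - F] have nondecreasing second derivatives on the
    half-line. Jensen's inequality in the variable [t ^ 2], applied to each, gives the two sides of
    the absolute value. *)
Lemma step_le (P P1 P2 : R -> R) x a :
  (forall y, is_derive y 1 P (P1 y)) -> (forall y, is_derive y 1 P1 (P2 y)) ->
  P1 0 = 0 -> tame P -> 0 < a ->
  (forall r t, 0 <= r -> r <= t ->
    `|h2 (x + t) + h2 (x - t) - (h2 (x + r) + h2 (x - r))| <= P2 t - P2 r) ->
  `|(h (x + a) + h (x - a)) / 2 - heat a h x|
    <= (normal_E (fun z => P (a * `|z|)) - P a) / 2.
Proof.
move=> dP dP1 P10 tP a0 hP.
pose F t := h (x + t) + h (x - t).
pose F1 t := h1 (x + t) - h1 (x - t).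
pose F2 t := h2 (x + t) + h2 (x - t).
have dF t : is_derive t 1 F (F1 t).
  have d1 := dh (x + t); have d2 := dh (x - t).
  by apply: is_derive_eq; rewrite /F1 /GRing.scale/=; ring.
have dF1 t : is_derive t 1 F1 (F2 t).
  have d1 := dh1 (x + t); have d2 := dh1 (x - t).
  by apply: is_derive_eq; rewrite /F2 /GRing.scale/=; ring.
have tF : tame F.
  apply: (@tame_ext (fun t => h (x + 1 * t) + h (x + (-1) * t))).
    by move=> t; rewrite mul1r mulN1r.
  by apply: tameD; exact: tame_affine.
(* [F] is even, which removes the absolute value, and the symmetry of the normal law makes its two
   summands contribute equally. *)
have EF : normal_E (fun z => F (a * `|z|)) = 2 * heat a h x.
  transitivity (normal_E (fun z => h (x + a * z) + h (x - a * z))).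
    apply: eq_normal_E => z; rewrite /F; case: (leP 0 z) => [z0|/ltW z0].
      by rewrite ger0_norm.
    by rewrite ler0_norm// mulrN opprK addrC.
  rewrite normal_ED ?heat_oppr//; [by rewrite mulr2n mulrDl !mul1r|exact: tame_affine|].
  by apply: (@tame_ext (fun z => h (x + (- a) * z))) (tame_affine _ _ tame_h) => z; rewrite mulNr.
have tabs (g : R -> R) : tame g -> tame (fun z => g (a * `|z|)).
  move=> /(tame_affine 0 a)/tame_comp_abs; apply: tame_ext => z.
  by rewrite add0r.
(* [even_convex] at [t = a |z|] integrates to [0] on the left since [E z^2 = 1]. *)
have key (H H1 H2 : R -> R) : (forall y, is_derive y 1 H (H1 y)) ->
    (forall y, is_derive y 1 H1 (H2 y)) -> H1 0 = 0 ->
    (forall r t, 0 <= r -> r <= t -> H2 r <= H2 t) -> tame H ->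
    H a <= normal_E (fun z => H (a * `|z|)).
  move=> dH dH1 H10 mono tH; rewrite -subr_ge0.
  rewrite -[H a]normal_E_cst -normal_EB; [|exact: tabs|exact: tame_cst].
  have -> : 0 = normal_E (fun z => H1 a / (2 * a) * (a ^+ 2 * z ^+ 2 - a ^+ 2)).
    have tz : tame (fun z : R => a ^+ 2 * z ^+ 2).
      by apply/tameZ/tameX; exact: tame_id.
    rewrite normal_EZ; last by apply: tameB => //; exact: tame_cst.
    rewrite normal_EB//; last exact: tame_cst.
    rewrite normal_EZ; last by apply/tameX; exact: tame_id.
    by rewrite normal_E_sqr normal_E_cst mulr1 subrr mulr0.
  apply: le_normal_E.
  - apply/tameZ/tameB; last exact: tame_cst.
    by apply/tameZ/tameX; exact: tame_id.
  - by apply: tameB; [exact: tabs|exact: tame_cst].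
  - move=> z; have := even_convex dH dH1 H10 mono a0 (mulr_ge0 (ltW a0) (normr_ge0 z)).
    by rewrite exprMn real_normK ?num_real.
have F10 : F1 0 = 0 by rewrite /F1 addr0 subr0 subrr.
have kp := key (fun y => P y + F y) (fun y => P1 y + F1 y) (fun y => P2 y + F2 y).
have km := key (fun y => P y - F y) (fun y => P1 y - F1 y) (fun y => P2 y - F2 y).
have {}kp : P a + F a <= normal_E (fun z => P (a * `|z|)) + 2 * heat a h x.
  rewrite -EF -normal_ED; [|exact: tabs|exact: tabs].
  apply: kp.
  - by rewrite P10 F10 addr0.
  - by move=> r t r0 rt; have := hP r t r0 rt; rewrite ler_norml /F2 => /andP[]; lra.
  - exact: tameD.
have {}km : P a - F a <= normal_E (fun z => P (a * `|z|)) - 2 * heat a h x.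
  rewrite -EF -normal_EB; [|exact: tabs|exact: tabs].
  apply: km.
  - by rewrite P10 F10 subr0.
  - by move=> r t r0 rt; have := hP r t r0 rt; rewrite ler_norml /F2 => /andP[]; lra.
  - exact: tameB.
by move: kp km; rewrite /F ler_norml => ? ?; apply/andP; split; lra.
Qed.

End step.

(** * Smoothing a function whose second derivative is Lipschitz *)

Section lipschitz_second_derivative.
Variables (f u l : R -> R).
Hypothesis df : forall x, is_derive x 1 f (u x).
Hypothesis du : forall x, is_derive x 1 u (l x).
Hypothesis lip : forall x y, `|l x - l y| <= `|x - y|.

Lemma tame_lip_deriv2 : tame l. Proof. exact: tame_lipschitz. Qed.
Lemma tame_lip_deriv1 : tame u. Proof. exact: (tame_primitive du tame_lip_deriv2). Qed.
Lemma tame_lip_deriv0 : tame f. Proof. exact: (tame_primitive df tame_lip_deriv1). Qed.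

Lemma taylor_deriv1 y h : `|u (y + h) - u y - h * l y| <= h ^+ 2.
Proof.
rewrite -(real_normK (num_real h)) expr2; apply: (taylor1 du) => x xh.
exact: le_trans (lip x y) xh.
Qed.

(** The weight [c] is constant for the plain second derivative, and the identity for the third
    derivative in Stein's form. *)
Lemma is_derive_weighted_heat1 s (c : R -> R) x : tame c ->
  is_derive x 1 (fun x => normal_E (fun z => u (x + s * z) * c z))
    (normal_E (fun z => l (x + s * z) * c z)).
Proof.
move=> tc.
apply: (@is_derive_normal_E _ (fun x z => u (x + s * z) * c z) _ (fun z => `|c z|)).
- by move=> y; apply: tameM => //; apply: tame_affine; exact: tame_lip_deriv1.
- by apply: tameM => //; apply: tame_affine; exact: tame_lip_deriv2.
- exact: tame_abs.
- move=> h z _; rewrite (_ : _ - _ - _ =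
    (u (x + s * z + h) - u (x + s * z) - h * l (x + s * z)) * c z).
    by rewrite normrM ler_wpM2r// taylor_deriv1.
  by rewrite (addrAC x h); ring.
Qed.

Lemma is_derive_heat0 s x : is_derive x 1 (heat s f) (heat s u x).
Proof.
apply: (@is_derive_normal_E _ (fun x z => f (x + s * z)) _ (fun z => `|l (x + s * z)| + 1)).
- by move=> y; apply: tame_affine; exact: tame_lip_deriv0.
- by apply: tame_affine; exact: tame_lip_deriv1.
- by apply: tameD; [apply/tame_abs/tame_affine; exact: tame_lip_deriv2|exact: tame_cst].
- move=> h z h1; rewrite (addrAC x h); set y := x + s * z.
  rewrite -(real_normK (num_real h)) expr2 -mulrA; apply: (taylor1 df) => v vh.
  have [c] := mean_value_abs y v du => cy ->.
  rewrite normrM mulrC ler_pM//.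
  have := lip c y; have := ler_normD (l c - l y) (l y); rewrite subrK.
  by move: (le_trans cy vh); lra.
Qed.

Lemma is_derive_heat1 s x : is_derive x 1 (heat s u) (heat s l x).
Proof.
have := @is_derive_weighted_heat1 s (fun=> 1) x (tame_cst 1).
rewrite (_ : (fun x => _) = heat s u).
  by rewrite (_ : normal_E _ = heat s l x)//; apply: eq_normal_E => z; rewrite mulr1.
by apply/funext => y; apply: eq_normal_E => z; rewrite mulr1.
Qed.

(* Stein's identity trades the non-differentiable [l] for [u], which can be
   differentiated under the expectation. *)
Lemma heat2_stein s x : 0 < s ->
  heat s l x = s^-1 * normal_E (fun z => u (x + s * z) * z).
Proof.
move=> s0; have tu := tame_affine x s tame_lip_deriv1; have tl := tame_affine x s tame_lip_deriv2.
have d (z : R) : is_derive z 1 (fun z => u (x + s * z)) (s * l (x + s * z)).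
  have dz := du (x + s * z).
  by apply: is_derive_eq; rewrite /GRing.scale/=; ring.
rewrite -(stein d tu (tameZ s tl)).
by rewrite normal_EZ// mulrA mulVf ?mul1r// gt_eqF.
Qed.

Lemma is_derive_heat2 s x : 0 < s ->
  is_derive x 1 (heat s l) (s^-1 * normal_E (fun z => l (x + s * z) * z)).
Proof.
move=> s0.
rewrite (_ : heat s l = fun x => s^-1 * normal_E (fun z => u (x + s * z) * z)).
  have d := @is_derive_weighted_heat1 s id x (@tame_id R).
  by apply: is_derive_eq.
by apply/funext => y; exact: heat2_stein.
Qed.

(** The mean of [|Z|] divided by [s]: a Lipschitz constant for the third derivative of
    [heat s f]. *)
Let M s : R := 2 / Num.sqrt (2 * pi) / s.

Lemma heat3_lipschitz s x y : 0 < s ->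
  `|s^-1 * normal_E (fun z => l (x + s * z) * z) -
    s^-1 * normal_E (fun z => l (y + s * z) * z)| <= M s * `|x - y|.
Proof.
move=> s0; have tl v : tame (fun z => l (v + s * z) * z).
  by apply: tameM; [apply: tame_affine; exact: tame_lip_deriv2|exact: tame_id].
rewrite -mulrBr -normal_EB// normrM gtr0_norm ?invr_gt0// /M mulrAC mulrC ler_pM2r ?invr_gt0//.
apply: le_trans (normr_normal_E _) _; first exact: tameB.
rewrite -normal_E_abs mulrC -normal_EZ; last by apply: tame_abs; exact: tame_id.
apply: le_normal_E.
- by apply/tame_abs/tameB.
- by apply/tameZ/tame_abs; exact: tame_id.
- move=> z; rewrite -mulrBl normrM ler_wpM2r//.
  by apply: le_trans (lip _ _) _; rewrite opprD addrACA subrr addr0.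
Qed.

(** The derivative in [t] of the symmetric sum is a difference of third derivatives at distance
    [2 * t], hence at most [2 * M s * t] in absolute value, the derivative of [M s * t ^ 2]. *)
Lemma heat2_second_diff s x r t : 0 < s -> 0 <= r -> r <= t ->
  `|heat s l (x + t) + heat s l (x - t) - (heat s l (x + r) + heat s l (x - r))|
    <= M s * (t ^+ 2 - r ^+ 2).
Proof.
move=> s0 r0 rt; pose k x := s^-1 * normal_E (fun z => l (x + s * z) * z).
have dk y : is_derive y 1 (heat s l) (k y) := is_derive_heat2 y s0.
have dF y : is_derive y 1 (fun t => heat s l (x + t) + heat s l (x - t)) (k (x + y) - k (x - y)).
  have d1 := dk (x + y); have d2 := dk (x - y).
  by apply: is_derive_eq; rewrite /GRing.scale/=; ring.
have kb y : 0 <= y -> `|k (x + y) - k (x - y)| <= 2 * M s * y.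
  move=> y0; apply: le_trans (heat3_lipschitz _ _ s0) _.
  rewrite (_ : x + y - (x - y) = 2 * y); last by ring.
  by rewrite normrM !ger0_norm// mulrCA mulrA.
have dp y : is_derive y 1 (fun t => M s * t ^+ 2) (2 * M s * y).
  by apply: is_derive_eq; rewrite /GRing.scale/=; ring.
have y0 y : r <= y <= t -> 0 <= y by move=> /andP[ry _]; exact: le_trans ry.
have h1 := @is_derive_homo _ (fun t => M s * t ^+ 2 + (heat s l (x + t) + heat s l (x - t)))
  (fun y => 2 * M s * y + (k (x + y) - k (x - y))) r t (fun y => is_deriveD (dp y) (dF y)) rt.
have h2 := @is_derive_homo _ (fun t => M s * t ^+ 2 - (heat s l (x + t) + heat s l (x - t)))
  (fun y => 2 * M s * y - (k (x + y) - k (x - y))) r t (fun y => is_deriveB (dp y) (dF y)) rt.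
have h1' y : r <= y <= t -> 0 <= 2 * M s * y + (k (x + y) - k (x - y)).
  by move=> /y0/kb; rewrite ler_norml => /andP[]; lra.
have h2' y : r <= y <= t -> 0 <= 2 * M s * y - (k (x + y) - k (x - y)).
  by move=> /y0/kb; rewrite ler_norml => /andP[]; lra.
move: (h1 h1') (h2 h2') => {}h1 {}h2.
by rewrite ler_norml; apply/andP; split; lra.
Qed.

Lemma tame_heat s K : (forall x, `|f x| <= K) -> tame (heat s f).
Proof.
move=> fK; split; first exact: (is_derive_continuous (is_derive_heat0 s)).
exists K, 0%N => x; rewrite expr0 mulr1 -[K]normal_E_cst.
have tsf := tame_affine x s tame_lip_deriv0.
apply: le_trans (normr_normal_E tsf) _.
by apply: le_normal_E; [exact: tame_abs|exact: tame_cst|move=> z; exact: fK].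
Qed.

(** [step_le] with [P t = M s / 12 * t ^ 4]; since the fourth moment of the normal law is [3], the
    bound becomes [M s * a ^ 4 / 12]. *)
Lemma heat_step s x a K : 0 < s -> 0 < a -> (forall x, `|f x| <= K) ->
  `|(heat s f (x + a) + heat s f (x - a)) / 2 - heat a (heat s f) x|
   <= a ^+ 4 / (6 * s * Num.sqrt (2 * pi)).
Proof.
move=> s0 a0 fK; have t4 : tame (fun z : R => z ^+ 4) by apply: tameX; exact: tame_id.
apply: le_trans (@step_le _ _ _ (is_derive_heat0 s) (is_derive_heat1 s) (tame_heat s fK)
  (fun t => M s / 12 * t ^+ 4) (fun t => M s / 3 * t ^+ 3) (fun t => M s * t ^+ 2) x a _ _ _ _ a0 _) _.
- by move=> y; apply: is_derive_eq; rewrite /GRing.scale/=; field.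
- by move=> y; apply: is_derive_eq; rewrite /GRing.scale/=; field.
- by rewrite expr0n/= mulr0.
- exact: tameZ.
- by move=> r t r0 rt; rewrite -mulrBr; exact: heat2_second_diff.
rewrite (@eq_normal_E _ _ (fun z => M s / 12 * a ^+ 4 * z ^+ 4)) => [|z]; last first.
  by rewrite exprMn mulrA -normrX (ger0_norm (exprn_even_ge0 _ _)).
rewrite normal_EZ// normal_E_pow4 /M le_eqVlt; apply/orP; left; apply/eqP; field.
by rewrite !gt_eqF ?sqrt_2pi_gt0.
Qed.

(** Without smoothing, each of the two translates of [l] changes by at most [t - r], whence
    [P2 t = 2 * t] and the absolute third moment of the normal law. *)
Lemma heat_step0 x a : 0 < a ->
  `|(f (x + a) + f (x - a)) / 2 - heat a f x|
   <= a ^+ 3 / 6 * (4 / Num.sqrt (2 * pi) - 1).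
Proof.
move=> a0; have t3 : tame (fun z : R => z ^+ 3) by apply: tameX; exact: tame_id.
apply: le_trans (@step_le _ _ _ df du tame_lip_deriv0 (fun t => 3^-1 * t ^+ 3) (fun t => t ^+ 2)
  (fun t => 2 * t) x a _ _ _ _ a0 _) _.
- by move=> y; apply: is_derive_eq; rewrite /GRing.scale/=; field.
- by move=> y; apply: is_derive_eq; rewrite /GRing.scale/=; ring.
- by rewrite expr0n/=.
- exact: tameZ.
- move=> r t r0 rt; have := lip (x + t) (x + r); have := lip (x - t) (x - r).
  rewrite (_ : x - t - (x - r) = - (t - r)); last by ring.
  rewrite (_ : x + t - (x + r) = t - r); last by ring.
  rewrite normrN (ger0_norm (_ : 0 <= t - r)) ?subr_ge0// !ler_norml.
  by move=> /andP[? ?] /andP[? ?]; apply/andP; split; lra.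
rewrite (@eq_normal_E _ _ (fun z => 3^-1 * a ^+ 3 * `|z| ^+ 3)) => [|z]; last first.
  by rewrite exprMn mulrA.
rewrite normal_EZ; last by apply/tameX/tame_abs; exact: tame_id.
rewrite normal_E_abs3 le_eqVlt; apply/orP; left; apply/eqP; field.
by rewrite !gt_eqF ?sqrt_2pi_gt0.
Qed.

End lipschitz_second_derivative.
End heat.

(** * The standardized binomial law as an iterated symmetric walk *)

Definition walk {R : realType} (a : R) (f : R -> R) (x : R) : R :=
  (f (x + a) + f (x - a)) / 2.

Definition binomial_E {R : realType} (n : nat) (f : R -> R) : R :=
  \sum_(k < n.+1) b_half n k * f ((2 * k%:R - n%:R) / Num.sqrt n%:R).

Section binomial.
Context {R : realType}.
Implicit Types (f : R -> R) (x y a b h t r s : R).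

(** A step up shifts the index [k] by one and a step down keeps it; Pascal's rule merges the two
    sums. *)
Lemma walk_binomial a f n x :
  iter n (walk a) f x = \sum_(k < n.+1) b_half n k * f (x + (2 * k%:R - n%:R) * a).
Proof.
elim: n x => [|n ih] x.
  rewrite big_ord1 /b_half/= bin0 expr0 invr1 mul1r mulr0 subrr.
  by rewrite mul0r addr0 mul1r.
rewrite iterS {1}/walk !ih.
pose g k := f (x + (2 * k%:R - n.+1%:R) * a) : R.
have E1 : \sum_(k < n.+1) b_half n k * f (x + a + (2 * k%:R - n%:R) * a) =
          (2 ^+ n)^-1 * \sum_(k < n.+1) 'C(n, k)%:R * g k.+1.
  rewrite mulr_sumr; apply: eq_bigr => k _; rewrite /b_half /g.
  rewrite mulrAC [RHS]mulrC; congr (_ * f _ / _).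
  by rewrite -[k.+1%:R]natr1 -[n.+1%:R]natr1; ring.
have E2 : \sum_(k < n.+1) b_half n k * f (x - a + (2 * k%:R - n%:R) * a) =
          (2 ^+ n)^-1 * \sum_(k < n.+1) 'C(n, k)%:R * g k.
  rewrite mulr_sumr; apply: eq_bigr => k _; rewrite /b_half /g.
  rewrite mulrAC [RHS]mulrC; congr (_ * f _ / _).
  by rewrite -[n.+1%:R]natr1; ring.
have -> : \sum_(k < n.+2) b_half n.+1 k * f (x + (2 * k%:R - n.+1%:R) * a) =
          (2 ^+ n.+1)^-1 * \sum_(k < n.+2) 'C(n.+1, k)%:R * g k.
  by rewrite mulr_sumr; apply: eq_bigr => k _; rewrite /b_half /g mulrAC [RHS]mulrC.
have -> : \sum_(k < n.+2) 'C(n.+1, k)%:R * g k =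
    \sum_(k < n.+1) 'C(n, k)%:R * g k.+1 + \sum_(k < n.+1) 'C(n, k)%:R * g k.
  rewrite big_ord_recl/=.
  under eq_bigr do rewrite /bump/= add1n binS natrD mulrDl.
  rewrite big_split/= addrA addrC; congr (_ + _).
  have : \sum_(k < n.+2) 'C(n, k)%:R * g k = \sum_(k < n.+1) 'C(n, k)%:R * g k.
    by rewrite big_ord_recr/= bin_small// mul0r addr0.
  by rewrite big_ord_recl/= !bin0 => <-.
rewrite E1 E2 exprS invfM; ring.
Qed.

Lemma binomial_E_walk n f : binomial_E n f = iter n (walk (Num.sqrt n%:R)^-1) f 0.
Proof. by rewrite walk_binomial; apply: eq_bigr => k _; rewrite add0r. Qed.

Lemma standardizeE n k :
  @standardize R n k = (2 * k%:R - n%:R) / Num.sqrt n%:R.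
Proof.
rewrite /standardize sqrtrM ?ler0n// sqrtrV//.
have -> : Num.sqrt 4 = 2 :> R.
  by rewrite (_ : 4 = 2 ^+ 2); [rewrite sqrtr_sqr ger0_norm|rewrite -natrX].
(* For [n = 0] both sides vanish, since the inverse of [0] is [0]. *)
case: n => [|n]; first by rewrite sqrtr0 mul0r invr0 !mulr0.
by field; rewrite gt_eqF// sqrtr_gt0 ltr0n.
Qed.

Lemma ge0_integral_std_binomial n f : measurable_fun setT f -> (forall x, 0 <= f x) ->
  (\int[std_binomial n]_x (f x)%:E = (binomial_E n f)%:E)%E.
Proof.
move=> mf f0; rewrite /std_binomial ge0_integral_distribution//; last exact/measurable_EFinP.
have p0 : 0 <= 2^-1 :> R by [].
have p1 : (NngNum p0)%:num <= 1 by rewrite /= invf_le1// ler1n.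
rewrite (integral_binomial n p1) => [|k]; last by rewrite lee_fin.
rewrite /binomial_E -sumEFin; apply: eq_bigr => k _.
rewrite -EFinM /= standardizeE; congr (_ * _)%:E.
rewrite /b_half /unstable.onem (_ : 1 - 2^-1 = 2^-1); last by field.
by rewrite -exprD subnKC -1?ltnS// -[LHS]mulr_natl exprVn.
Qed.

Lemma integrable_std_binomial n f : measurable_fun setT f ->
  (std_binomial n).-integrable setT (EFin \o f).
Proof.
move=> mf; apply/integrableP; split; first exact/measurable_EFinP.
rewrite (_ : (fun x => _) = fun x => (`|f x|)%:E)//.
by rewrite ge0_integral_std_binomial ?ltry//; exact: measurableT_comp.
Qed.

Lemma integral_std_binomial n f : measurable_fun setT f ->
  (\int[std_binomial n]_x (f x)%:E = (binomial_E n f)%:E)%E.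
Proof.
move=> mf; have ma : measurable_fun setT (fun x => `|f x|) by exact: measurableT_comp.
have mb : measurable_fun setT (fun x => `|f x| - f x) by exact: measurable_funB.
transitivity (\int[std_binomial n]_x ((`|f x|)%:E - (`|f x| - f x)%:E))%E.
  by apply: eq_integral => x _; rewrite -EFinB; congr EFin; ring.
rewrite integralB//; [|exact: integrable_std_binomial|exact: integrable_std_binomial].
rewrite !ge0_integral_std_binomial//; last by move=> x; rewrite subr_ge0 ler_norm.
rewrite -EFinB /binomial_E -sumrB; congr EFin.
by apply: eq_bigr => k _; ring.
Qed.

End binomial.

(** * Telescoping between the walk and the Gaussian semigroup *)

Section lindeberg.
Context {R : realType}.
Variables (f u l : R -> R) (K : R).
Hypothesis df : forall x : R, is_derive x 1 f (u x).
Hypothesis du : forall x : R, is_derive x 1 u (l x).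
Hypothesis lip : forall x y, `|l x - l y| <= `|x - y|.
Hypothesis fK : forall x, `|f x| <= K.

Lemma walkB a (g h : R -> R) x : walk a (fun y => g y - h y) x = walk a g x - walk a h x.
Proof. by rewrite /walk; field. Qed.

Lemma walk_le a (g : R -> R) B x : (forall y, `|g y| <= B) -> `|walk a g x| <= B.
Proof.
move=> gB; rewrite /walk normrM (ger0_norm (_ : 0 <= 2^-1)) ?invr_ge0//.
by have := ler_normD (g (x + a)) (g (x - a)); have := gB (x + a); have := gB (x - a); lra.
Qed.

(** In the induction step the old error, bounded uniformly in [x], passes through [walk a] without
    growing. The new error is [heat_step] at scale [Num.sqrt n.+1%:R * a], which is the next term of
    the sum. *)
Lemma walk_heat n a x : 0 < a ->
  `|iter n.+1 (walk a) f x - heat (Num.sqrt n.+1%:R * a) f x| <=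
  a ^+ 3 / 6 * (4 / Num.sqrt (2 * pi) - 1) +
  a ^+ 3 / (6 * Num.sqrt (2 * pi)) * \sum_(1 <= k < n.+1) (Num.sqrt k%:R)^-1.
Proof.
move=> a0; elim: n x => [|n ih] x.
  rewrite sqrtr1 mul1r big_geq// mulr0 addr0 /=.
  exact: (heat_step0 df du lip).
have s0 : 0 < Num.sqrt n.+1%:R :> R by rewrite sqrtr_gt0 ltr0n.
have sa0 : 0 < Num.sqrt n.+1%:R * a by rewrite mulr_gt0.
have <- : heat a (heat (Num.sqrt n.+1%:R * a) f) x = heat (Num.sqrt n.+2%:R * a) f x.
  rewrite (@heat_semigroup _ _ _ _ K)//.
  - congr (heat _ f x); rewrite exprMn sqr_sqrtr ?ler0n// -[X in X + _]mul1r -mulrDl.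
    by rewrite sqrtrM ?addr_ge0// sqrtr_sqr gtr0_norm// -[in RHS]natr1 addrC.
  - exact: (tame_lip_deriv0 df du lip).
  - exact: (tame_heat df du lip _ fK).
  - by move=> y; have := fK y; rewrite ler_norml => /andP[].
rewrite iterS -/(iter n.+1 _ _).
have -> : walk a (iter n.+1 (walk a) f) x - heat a (heat (Num.sqrt n.+1%:R * a) f) x =
  walk a (fun y => iter n.+1 (walk a) f y - heat (Num.sqrt n.+1%:R * a) f y) x +
  (walk a (heat (Num.sqrt n.+1%:R * a) f) x - heat a (heat (Num.sqrt n.+1%:R * a) f) x).
  by rewrite walkB; ring.
apply: le_trans (ler_normD _ _) _.
rewrite [X in _ <= _ + _ * X]big_nat_recr//= [X in _ <= _ + X]mulrDr addrA lerD//; first exact: walk_le.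
apply: le_trans (heat_step df du lip x sa0 a0 fK) _.
rewrite le_eqVlt; apply/orP; left; apply/eqP; field.
by rewrite !gt_eqF ?sqrt_2pi_gt0.
Qed.

Lemma binomial_normal_le n : (0 < n)%N ->
  `|binomial_E n f - normal_E f| <=
  (6 * n%:R * Num.sqrt n%:R)^-1 * ((4 / Num.sqrt (2 * pi) - 1) +
   (Num.sqrt (2 * pi))^-1 * \sum_(1 <= k < n) (Num.sqrt k%:R)^-1).
Proof.
case: n => // n _; rewrite binomial_E_walk.
have s0 : 0 < Num.sqrt n.+1%:R :> R by rewrite sqrtr_gt0 ltr0n.
have a0 : 0 < (Num.sqrt n.+1%:R)^-1 :> R by rewrite invr_gt0.
have := walk_heat n 0 a0; rewrite mulfV ?gt_eqF//.
have -> : heat 1 f 0 = normal_E f.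
  by apply: eq_normal_E => z; rewrite add0r mul1r.
move=> /le_trans; apply; rewrite le_eqVlt; apply/orP; left; apply/eqP.
rewrite (_ : 6 * n.+1%:R * _ = 6 * Num.sqrt n.+1%:R ^+ 3); last first.
  by rewrite -{1}[n.+1%:R](sqr_sqrtr (ler0n R n.+1)); ring.
move: (\sum_(_ <= _ < _) _) (Num.sqrt n.+1%:R) s0 {a0} => S s s0; field.
by rewrite !gt_eqF ?sqrt_2pi_gt0.
Qed.

End lindeberg.

(** * Upper and lower estimates for the Zolotarev distance *)

Section zolotarev_std_binomial.
Context {R : realType}.
Implicit Types (f : R -> R) (x y : R) (n : nat).

Lemma F3P f : F3 f -> exists u l : R -> R, exists K : R,
  [/\ forall x, is_derive x 1 f (u x), forall x, is_derive x 1 u (l x),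
      forall x y, `|l x - l y| <= `|x - y| & forall x, `|f x| <= K].
Proof.
case=> bf d1 d2 _ lip; have [K [_ HK]] := bf.
(* Boundedness provides bounds only strictly above [K], whence [K + 1]. *)
exists (derive1 f), (derive1 (derive1 f)), (K + 1); split.
- by move=> x; rewrite derive1E; exact: derivableP.
- by move=> x; rewrite [X in is_derive _ _ _ X]derive1E; exact: derivableP.
- exact: lip.
- by move=> x; apply: HK => //; rewrite ltrDl.
Qed.

Lemma F3_integral_diff n f : F3 f ->
  (`|\int[std_binomial n]_x (f x)%:E - \int[std_normal]_x (f x)%:E| =
   `|binomial_E n f - normal_E f|%:E)%E.
Proof.
move=> /F3P[u [l [K [df du lip fK]]]]; have tf := tame_lip_deriv0 df du lip.
by rewrite integral_std_binomial ?EFin_normal_E//; exact: tame_measurable.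
Qed.

Lemma zolotarev_std_binomial_le n : (0 < n)%N ->
  (zolotarev3 (@std_binomial R n) std_normal <=
   ((6 * n%:R * Num.sqrt n%:R)^-1 * ((4 / Num.sqrt (2 * pi) - 1) +
   (Num.sqrt (2 * pi))^-1 * \sum_(1 <= k < n) (Num.sqrt k%:R)^-1))%:E)%E.
Proof.
move=> n0; apply: ge_ereal_sup => _ [f Ff <-]; rewrite F3_integral_diff// lee_fin.
have [u [l [K [df du lip fK]]]] := F3P Ff.
exact: (binomial_normal_le df du lip fK).
Qed.

Lemma le_zolotarev_std_binomial n f : F3 f ->
  (`|binomial_E n f - normal_E f|%:E <= zolotarev3 (@std_binomial R n) std_normal)%E.
Proof. by move=> Ff; rewrite -F3_integral_diff//; apply: ereal_sup_ubound; exists f. Qed.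

(** Away from [0] the function locally coincides with one branch; at [0] the difference quotients of
    both branches have the same limit. *)
Lemma is_derive_glue (A A1 B B1 : R -> R) : A 0 = B 0 -> A1 0 = B1 0 ->
  (forall x, is_derive x 1 A (A1 x)) -> (forall x, is_derive x 1 B (B1 x)) ->
  forall x, is_derive x 1 (fun y => if y < 0 then A y else B y)
                          (if x < 0 then A1 x else B1 x).
Proof.
move=> AB AB1 dA dB x; set f := fun y => _; case: ltrgt0P => [x0|x0|->].
- apply: (@near_eq_is_derive _ _ _ B) (dB x); near=> y.
  rewrite /f ltNge ltW//; near: y; exact: lt_nbhsr.
- apply: (@near_eq_is_derive _ _ _ A) (dA x); near=> y.
  rewrite /f ifT//; near: y; exact: lt_nbhsl.
have quot (g : R -> R) (d : R) : is_derive (0 : R) 1 g d ->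
    h^-1 *: (g (h *: 1 + 0) - g 0) @[h --> (0 : R)^'] --> d.
  by case=> cg <-; exact: cg.
have qA := quot _ _ (dA 0); have qB := quot _ _ (dB 0).
suff cv : h^-1 *: (f (h *: 1 + 0) - f 0) @[h --> (0 : R)^'] --> B1 0.
  by apply: DeriveDef; [apply/cvg_ex; exists (B1 0) | exact: cvg_lim].
apply/cvgrPdist_lt => e e0; near=> h.
rewrite /f ltxx; case: ifP => _.
  rewrite -AB -AB1; near: h; move/cvgrPdist_lt : qA; exact.
by near: h; move/cvgrPdist_lt : qB; exact.
Unshelve. all: by end_near. Qed.

(** Obtained by integrating [1 + t <= expR t] twice. *)
Lemma expR_ge_taylor3 (t : R) : 0 <= t -> 1 + t + t ^+ 2 / 2 + t ^+ 3 / 6 <= expR t.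
Proof.
have h2 (s : R) : 0 <= s -> 1 + s + s ^+ 2 / 2 <= expR s.
  move=> t0.
  have := @is_derive_homo _ (fun t => expR t - (1 + t + t ^+ 2 / 2))
    (fun t => expR t - (1 + t)) 0 s _ t0.
  rewrite expR0 expr0n/= mul0r !addr0 subrr subr_ge0; apply.
  - by move=> y; apply: is_derive_eq; rewrite /GRing.scale/=; field.
  - by move=> y _; rewrite subr_ge0 expR_ge1Dx.
move=> t0.
have := @is_derive_homo _ (fun t => expR t - (1 + t + t ^+ 2 / 2 + t ^+ 3 / 6))
  (fun t => expR t - (1 + t + t ^+ 2 / 2)) 0 t _ t0.
rewrite expR0 !expr0n/= !mul0r !addr0 subrr subr_ge0; apply.
- by move=> y; apply: is_derive_eq; rewrite /GRing.scale/=; field.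
- by move=> y /andP[y0 _]; rewrite subr_ge0 h2.
Qed.

(* [damped_cube m `|x|] lies in [F3] and tends to [`|x| ^+ 3 / 6], which is
   unbounded, as [m] grows: this gives the lower bound for the distance. *)
Section damped_cube.
Variable m : R.
Hypothesis m0 : 0 < m.

Definition damped_cube y : R := y ^+ 3 / 6 * expR (- y / m).

Let u1 y : R := (y ^+ 2 / 2 - y ^+ 3 / (6 * m)) * expR (- y / m).
Let u2 y : R := (y - y ^+ 2 / m + y ^+ 3 / (6 * m ^+ 2)) * expR (- y / m).
Let u3 y : R :=
  (1 - 3 * (y / m) + 3 / 2 * (y / m) ^+ 2 - (y / m) ^+ 3 / 6) * expR (- y / m).

Let d0 y : is_derive y 1 damped_cube (u1 y).
Proof.
by apply: is_derive_eq; rewrite /u1 /GRing.scale/=; field; rewrite gt_eqF.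
Qed.

Let d1 y : is_derive y 1 u1 (u2 y).
Proof.
by apply: is_derive_eq; rewrite /u2 /GRing.scale/=; field; rewrite gt_eqF.
Qed.

Let d2 y : is_derive y 1 u2 (u3 y).
Proof.
by apply: is_derive_eq; rewrite /u3 /GRing.scale/=; field; rewrite gt_eqF.
Qed.

(** With [t = y / m], the cubic factor is at most [1 + t + t ^ 2 / 2 + t ^ 3 / 6] in absolute value,
    hence at most [expR t]. This makes the Lipschitz constant [1] for every [m]. *)
Let u3_le1 y : 0 <= y -> `|u3 y| <= 1.
Proof.
move=> y0; have t0 : 0 <= y / m by rewrite divr_ge0// ltW.
rewrite /u3 mulNr; move: (y / m) t0 => t t0.
rewrite normrM (ger0_norm (expR_ge0 _)) expRN ler_pdivrMr ?expR_gt0// mul1r.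
apply: le_trans (expR_ge_taylor3 t0); rewrite ler_norml.
have t2 : 0 <= t ^+ 2 by rewrite sqr_ge0.
have t3 : 0 <= t ^+ 3 by rewrite exprn_ge0.
have q1 := sqr_ge0 (t - 1).
have q2 : 0 <= t * (t - 1) ^+ 2 by rewrite mulr_ge0// sqr_ge0.
by apply/andP; split; nra.
Qed.

(** The two halves can be glued because [u1 0 = 0], and the even second derivative [u2 |x|] is
    Lipschitz by [u3_le1]. *)
Lemma damped_cube_abs_F3 : F3 (fun x => damped_cube `|x|).
Proof.
have fE : (fun x => damped_cube `|x|) =
    fun x => if x < 0 then damped_cube (- x) else damped_cube x.
  apply/funext => x; case: ltP => x0; first by rewrite ltr0_norm.
  by rewrite ger0_norm.
pose f1 x := if x < 0 then - u1 (- x) else u1 x.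
pose f2 x := if x < 0 then u2 (- x) else u2 x.
have D0 x : is_derive x 1 (fun x => damped_cube `|x|) (f1 x).
  rewrite fE; apply: (@is_derive_glue (fun x => damped_cube (- x)) (fun x => - u1 (- x))); rewrite ?oppr0//.
  - by rewrite /u1 !expr0n/= !mul0r subrr mul0r oppr0.
  - move=> y; have dy := d0 (- y).
    by apply: is_derive_eq; rewrite /GRing.scale/=; ring.
have D1 x : is_derive x 1 f1 (f2 x).
  apply: (@is_derive_glue (fun x => - u1 (- x)) (fun x => u2 (- x))); rewrite ?oppr0//.
  - by rewrite /u1 !expr0n/= !mul0r subrr mul0r oppr0.
  - move=> y; have dy := d1 (- y).
    by apply: is_derive_eq; rewrite /GRing.scale/=; ring.
have f2E x : f2 x = u2 `|x|.
  by rewrite /f2; case: ltP => x0; [rewrite ltr0_norm|rewrite ger0_norm].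
have lip x y : `|f2 x - f2 y| <= `|x - y|.
  have mono a b : 0 <= a -> a <= b -> `|u2 b - u2 a| <= b - a.
    move=> a0 ab; have [c /andP[ac cb] ->] := mean_value d2 ab.
    rewrite normrM (ger0_norm (_ : 0 <= b - a)) ?subr_ge0//.
    by rewrite ler_piMl ?subr_ge0// u3_le1// (le_trans a0).
  rewrite !f2E; apply: le_trans (ler_dist_dist x y).
  have [xy|/ltW xy] := leP `|x| `|y|.
    by rewrite distrC [leRHS]distrC (ger0_norm (_ : 0 <= `|y| - `|x|)) ?subr_ge0// mono.
  by rewrite (ger0_norm (_ : 0 <= `|x| - `|y|)) ?subr_ge0// mono.
have E1 : derive1 (fun x => damped_cube `|x|) = f1.
  by apply/funext => x; rewrite derive1E; exact: derive_val.
have E2 : derive1 f1 = f2.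
  by apply/funext => x; rewrite derive1E; exact: derive_val.
split; rewrite ?E1 ?E2.
(* The bound [m ^ 3] comes from [t ^ 3 / 6 <= expR t] at [t = |x| / m]. *)
- exists (m ^+ 3); split; first exact: num_real.
  move=> K mK x _; apply: le_trans (ltW mK).
  have t0 : 0 <= `|x| / m by rewrite divr_ge0// ltW.
  rewrite ger0_norm /damped_cube ?mulr_ge0 ?expR_ge0 ?invr_ge0 ?exprn_ge0//.
  rewrite mulNr expRN ler_pdivrMr ?expR_gt0//.
  have : (`|x| / m) ^+ 3 / 6 <= expR (`|x| / m).
    by have := expR_ge_taylor3 t0; have := sqr_ge0 (`|x| / m); lra.
  rewrite -(ler_pM2l (exprn_gt0 3 m0)).
  by apply: le_trans; rewrite expr_div_n le_eqVlt; apply/orP; left; apply/eqP; field; rewrite gt_eqF.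
- by move=> x; exact: ex_derive.
- by move=> x; exact: ex_derive.
- exact: (tame_cts (tame_lipschitz lip)).
- exact: lip.
Qed.

(** From [1 - expR (- t) <= t] at [t = |x| / m]. The fourth power has a finite mean under both
    laws. *)
Lemma damped_cube_dist x :
  `|damped_cube `|x| - `|x| ^+ 3 / 6| <= x ^+ 4 / (6 * m).
Proof.
rewrite -[x ^+ 4](ger0_norm (exprn_even_ge0 _ _))// normrX.
have : 0 <= `|x| := normr_ge0 x; move: `|x| => y y0.
rewrite /damped_cube -{2}[y ^+ 3 / 6]mulr1 -mulrBr normrM ger0_norm ?divr_ge0 ?exprn_ge0//.
have -> : y ^+ 4 / (6 * m) = y ^+ 3 / 6 * (y / m) by field; rewrite gt_eqF.
rewrite ler_wpM2l ?divr_ge0 ?exprn_ge0//.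
have e1 : expR (- y / m) <= 1.
  by rewrite -expR0 ler_expR mulNr oppr_le0 divr_ge0// ltW.
have := expR_ge1Dx (- y / m); rewrite distrC ger0_norm ?subr_ge0//.
by rewrite mulNr; lra.
Qed.

End damped_cube.

Lemma le_zolotarev_abs_cube n :
  (`|binomial_E n (fun x : R => `|x| ^+ 3 / 6) - normal_E (fun x : R => `|x| ^+ 3 / 6)|%:E
   <= zolotarev3 (@std_binomial R n) std_normal)%E.
Proof.
set c := fun x : R => `|x| ^+ 3 / 6.
(* Damping changes the two expectations by at most [C / m] in total, where [3] is the fourth moment
   of the normal law. *)
pose C := (binomial_E n (fun x : R => x ^+ 4) + 3) / 6.
have tc : tame c.
  by apply: tameM; [apply/tameX/tame_abs; exact: tame_id|exact: tame_cst].
have H (m : R) : 0 < m -> (`|binomial_E n c - normal_E c|%:E - (C / m)%:E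
    <= zolotarev3 (@std_binomial R n) std_normal)%E.
  move=> m0; have FF := damped_cube_abs_F3 m0.
  apply: le_trans (le_zolotarev_std_binomial n FF).
  set g := fun x : R => damped_cube m `|x|.
  have tg : tame g.
    by have [u [l [K [df du lip _]]]] := F3P FF; exact: (tame_lip_deriv0 df du lip).
  have t4 : tame (fun x : R => x ^+ 4) by apply: tameX; exact: tame_id.
  have bg x : `|g x - c x| <= (6 * m)^-1 * x ^+ 4.
    by rewrite mulrC; exact: damped_cube_dist.
  have b1 : `|binomial_E n g - binomial_E n c| <=
      (6 * m)^-1 * binomial_E n (fun x : R => x ^+ 4).
    rewrite /binomial_E -sumrB mulr_sumr.
    apply: le_trans (ler_norm_sum _ _ _) _; apply: ler_sum => k _.
    rewrite -mulrBr normrM mulrCA ger0_norm ?ler_wpM2l// /b_half divr_ge0// ?exprn_ge0//.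
  have b2 : `|normal_E g - normal_E c| <= (6 * m)^-1 * 3.
    rewrite -normal_EB// -normal_E_pow4 -normal_EZ//.
    apply: le_trans (normr_normal_E _) _; first exact: tameB.
    by apply: le_normal_E => //; [apply/tame_abs/tameB|exact: tameZ].
  rewrite -EFinB lee_fin lerBlDr.
  have -> : C / m = (6 * m)^-1 * binomial_E n (fun x : R => x ^+ 4) + (6 * m)^-1 * 3.
    by rewrite /C; field; rewrite gt_eqF.
  have -> : binomial_E n c - normal_E c =
     (binomial_E n g - normal_E g) - (binomial_E n g - binomial_E n c) +
     (normal_E g - normal_E c) by ring.
  apply: le_trans (ler_normD _ _) _; rewrite addrA lerD//.
  by apply: le_trans (ler_normB _ _) _; rewrite lerD.
apply/lee_addgt0Pr => e e0.
have C0 : 0 <= C.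
  rewrite divr_ge0// addr_ge0// sumr_ge0// => k _.
  by rewrite mulr_ge0 ?exprn_even_ge0// divr_ge0 ?ler0n// exprn_ge0.
(* For [m = (C + 1) / e] the damping costs at most [e]; the summand [1] makes [m] positive from
   [0 <= C] alone. *)
have m0 : 0 < (C + 1) / e by rewrite divr_gt0// ltr_wpDl.
have := H _ m0; rewrite leeBlDr// => /le_trans; apply.
rewrite leeD2l// lee_fin invf_div mulrA ler_pdivrMr ?ltr_wpDl//.
by rewrite mulrC ler_wpM2l ?(ltW e0)// lerDl.
Qed.

End zolotarev_std_binomial.

(** * Euler-Maclaurin bounds for [zeta (1/2)] *)

Section zeta_half.
Context {R : realType}.
Implicit Types (n k : nat) (x y c : R).

Local Notation a n := (Num.sqrt n%:R : R).

(** Euler-Maclaurin: the partial sum less the integral of [x ^ (-1/2)] over [[0, n]] and less half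
    of the last term. *)
Let u n : R := \sum_(1 <= k < n.+1) (a k)^-1 - 2 * a n - (2 * a n)^-1.

Let a_gt0 n : (0 < n)%N -> 0 < a n. Proof. by move=> n0; rewrite sqrtr_gt0 ltr0n. Qed.

Let a_sqr n : a n ^+ 2 = n%:R. Proof. by rewrite sqr_sqrtr. Qed.

Let a_sqrS n : a n.+1 ^+ 2 = a n ^+ 2 + 1. Proof. by rewrite !a_sqr natr1. Qed.

(** With [x = a n] and [y = a n.+1], [y ^ 2 - x ^ 2 = 1] gives [y - x = (x + y)^-1], and the error
    of the trapezoidal rule becomes a multiple of [(y - x) ^ 2]. *)
Let uS n : (0 < n)%N -> u n.+1 - u n = (2 * (a n * a n.+1) * (a n + a n.+1) ^+ 3)^-1.
Proof.
move=> n0; rewrite /u big_nat_recr//=; have := a_gt0 n0; have := a_gt0 (ltn0Sn n).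
have := a_sqrS n; move: (\sum_(_ <= _ < _) _) (a n) (a n.+1) => S x y xy y0 x0.
have xy0 : 0 < x + y by rewrite addr_gt0.
have d : y - x = (x + y)^-1.
  apply: (mulIf (lt0r_neq0 xy0)); rewrite mulVf ?gt_eqF//.
  have -> : (y - x) * (x + y) = y ^+ 2 - x ^+ 2 by ring.
  by rewrite xy; ring.
have -> : S + y^-1 - 2 * y - (2 * y)^-1 - (S - 2 * x - (2 * x)^-1) =
  (x + y) / (2 * (x * y)) - 2 * (y - x) by field; rewrite !gt_eqF.
have -> : (x + y) / (2 * (x * y)) - 2 * (y - x) = (y - x) ^+ 2 / (2 * (x * y) * (x + y)).
  rewrite {1}d; have -> : (y - x) ^+ 2 = (x + y) ^+ 2 - 4 * (x * y) by ring.
  by field; rewrite !gt_eqF.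
by rewrite d; field; rewrite !gt_eqF.
Qed.

Let u_homo n : (0 < n)%N -> u n <= u n.+1.
Proof.
by move=> n0; rewrite -subr_ge0 uS// invr_ge0.
Qed.

(* With [p = xy], [S = x ^ 2 + y ^ 2], the difference of [u n + c x ^ -3] is
   controlled by the sign of [p ^ 2 - 2 c (S + 2 p) (S + p)]. *)
Let corrected_diff x y c : 0 < x -> 0 < y -> y ^+ 2 = x ^+ 2 + 1 ->
  (2 * (x * y) * (x + y) ^+ 3)^-1 + c / y ^+ 3 - c / x ^+ 3 =
  ((x * y) ^+ 2 - 2 * c * (x ^+ 2 + y ^+ 2 + 2 * (x * y)) * (x ^+ 2 + y ^+ 2 + x * y))
  / (2 * (x * y) ^+ 3 * (x + y) ^+ 3).
Proof.
move=> x0 y0 yx; have xy0 : 0 < x + y by rewrite addr_gt0.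
rewrite -addrA.
have -> : c / y ^+ 3 - c / x ^+ 3 =
  - c * ((y ^+ 2 - x ^+ 2) * (x ^+ 2 + y ^+ 2 + x * y) / ((x + y) * (x * y) ^+ 3)).
  by field; rewrite !gt_eqF.
by rewrite {1}yx addrAC subrr add0r mul1r; field; rewrite !gt_eqF.
Qed.

(* [1 / 24] is the next Euler-Maclaurin coefficient; lowering it slightly reverses
   the monotonicity from [n = 4] on, which brackets the limit at [n = 4]. *)
Let up n := u n + 24^-1 / a n ^+ 3.
Let lo n := u n + (242 / 10)^-1 / a n ^+ 3.

(** For [c = 1 / 24] the sign follows from [S >= 2 p], which gives
    [(S + 2 p) (S + p) >= 12 p ^ 2]. *)
Let up_homo n : (0 < n)%N -> up n.+1 <= up n.
Proof.
move=> n0; rewrite -subr_le0 /up.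
rewrite (_ : _ - _ = (u n.+1 - u n) + 24^-1 / a n.+1 ^+ 3 - 24^-1 / a n ^+ 3); last by ring.
have x0 := a_gt0 n0; have y0 := a_gt0 (ltn0Sn n).
rewrite uS// corrected_diff ?a_sqrS// -a_sqrS mulr_le0_ge0 ?invr_ge0 ?mulr_ge0 ?exprn_ge0 ?addr_ge0//.
rewrite subr_le0; move: (a n) (a n.+1) x0 y0 => x y x0 y0.
have p0 : 0 < x * y by rewrite mulr_gt0.
have h : 2 * (x * y) <= x ^+ 2 + y ^+ 2 by have := sqr_ge0 (x - y); nra.
move: (x * y) (x ^+ 2 + y ^+ 2) p0 h => p S p0 h.
by nra.
Qed.

(** Since [S ^ 2 = 1 + 4 p ^ 2] and [p S <= 2 p ^ 2 + 1 / 4], the sign condition holds once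
    [p ^ 2 >= 35 / 2]; here [p ^ 2 = n (n + 1) >= 20]. *)
Let lo_homo n : (4 <= n)%N -> lo n <= lo n.+1.
Proof.
move=> n4; have n0 : (0 < n)%N by exact: leq_trans n4.
rewrite -subr_ge0 /lo.
rewrite (_ : _ - _ = (u n.+1 - u n) + (242 / 10)^-1 / a n.+1 ^+ 3 - (242 / 10)^-1 / a n ^+ 3); last by ring.
have x0 := a_gt0 n0; have y0 := a_gt0 (ltn0Sn n).
have p20 : 20 <= (a n * a n.+1) ^+ 2.
  by rewrite exprMn !a_sqr -natrM ler_nat (@leq_mul 4 5).
have yx := a_sqrS n.
rewrite (uS n0) (corrected_diff _ x0 y0 yx).
move: (a n) (a n.+1) x0 y0 p20 yx => x y x0 y0 p20 yx.
have D0 : 0 <= 2 * (x * y) ^+ 3 * (x + y) ^+ 3.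
  by rewrite mulr_ge0// ?mulr_ge0 ?exprn_ge0 ?addr_ge0 ?mulr_ge0 ?ltW.
apply: divr_ge0 D0.
have p0 : 0 < x * y by rewrite mulr_gt0.
have S2 : (x ^+ 2 + y ^+ 2) ^+ 2 = 1 + 4 * (x * y) ^+ 2 by rewrite exprMn yx; ring.
have S0 : 0 <= x ^+ 2 + y ^+ 2 by rewrite addr_ge0 ?sqr_ge0.
move: (x * y) (x ^+ 2 + y ^+ 2) p0 S2 S0 p20 => p S p0 S2 S0 p20.
have pS : p * S <= 2 * p ^+ 2 + 1 / 4.
  rewrite -(@ler_pXn2r _ 2) ?nnegrE ?addr_ge0 ?mulr_ge0 ?sqr_ge0 ?(ltW p0)//.
  by rewrite exprMn S2; nra.
have -> : 2 * (242 / 10)^-1 * (S + 2 * p) * (S + p) =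
  2 * (242 / 10)^-1 * (S ^+ 2 + 3 * (p * S) + 2 * p ^+ 2) by ring.
rewrite S2; lra.
Qed.

Let inv_a_cvg : (a n)^-1 @[n --> \oo] --> (0 : R).
Proof.
apply/cvgrPdist_lt => e e0; near=> n.
have n0 : (0 < n)%N by near: n; exact: nbhs_infty_gt.
rewrite sub0r normrN ger0_norm ?invr_ge0// invf_plt ?posrE ?a_gt0//.
rewrite -(@ltr_pXn2r _ 2) ?nnegrE ?invr_ge0 ?(ltW e0)// a_sqr.
by near: n; exact: nbhs_infty_gtr.
Unshelve. all: by end_near. Qed.

Lemma cvg_homo_ge (w : nat -> R) l m : (forall n, (m <= n)%N -> w n <= w n.+1) ->
  w @ \oo --> l -> w m <= l.
Proof.
move=> hw wl; rewrite -(cvg_lim (@Rhausdorff R) wl).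
apply: limr_ge; first by apply/cvg_ex; exists l.
near=> n.
have mn : (m <= n)%N by near: n; exact: nbhs_infty_ge.
rewrite -(subnK mn); elim: (n - m)%N => [//|k ih].
by apply: le_trans ih _; rewrite addSn hw// leq_addl.
Unshelve. all: by end_near. Qed.

Local Notation zeta := (riemann_zeta (1 / 2) : R).

Let u_cvg : u @ \oo --> zeta.
Proof.
have uc : cvgn u.
  (* With the default inverse of [0], [u 0 = 0] exceeds [u 1], so monotonicity starts at [1] and the
     sequence is shifted. *)
  suff /cvg_ex[/= l ul] : cvgn (fun n => u n.+1).
    by apply/cvg_ex; exists l; rewrite -cvg_shiftS.
  apply: nondecreasing_is_cvgn.
    by apply/nondecreasing_seqP => n; exact: u_homo.
  exists (up 1) => _ [n _ <-] /=; apply: le_trans (_ : up n.+1 <= _).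
    by rewrite /up lerDl.
  by elim: n => [//|n ih]; apply: le_trans ih; exact: up_homo.
have v_cvg : (fun n => \sum_(1 <= k < n.+1) (a k)^-1 - 2 * a n) @ \oo --> limn u.
  rewrite (_ : (fun n => _) = fun n => u n + 2^-1 * (a n)^-1); last first.
    by apply/funext => n; rewrite /u invfM subrK.
  rewrite -[X in _ --> X]addr0; apply: cvgD => //.
  rewrite -[X in _ --> X](mulr0 2^-1); apply: cvgM; first exact: cvg_cst.
  exact: inv_a_cvg.
suff -> : zeta = limn u by [].
rewrite -(cvg_lim (@Rhausdorff R) v_cvg) /riemann_zeta; congr (limn _).
apply/funext => n; have h : 1 - 1 / 2 = 2^-1 :> R by field.
rewrite h powR12_sqrt// invrK (mulrC _ 2); congr (_ - _).
by apply: eq_bigr => k _; rewrite mul1r powRN powR12_sqrt.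
Qed.

(** Removing the term [k = n] from [u n <= zeta] leaves a spare [- (2 * a n)^-1], which makes the
    inequality strict. *)
Lemma sum_inv_sqrt_lt n : (0 < n)%N ->
  \sum_(1 <= k < n) (a k)^-1 < 2 * a n + zeta.
Proof.
move=> n0; have : u n <= zeta.
  by apply: cvg_homo_ge u_cvg => k nk; apply: u_homo; exact: leq_trans nk.
have := a_gt0 n0; rewrite -invr_gt0 /u big_nat_recr//= invfM; lra.
Qed.

Let corr_cvg c : u n + c / a n ^+ 3 @[n --> \oo] --> zeta.
Proof.
rewrite -[X in _ --> X]addr0; apply: cvgD; first exact: u_cvg.
rewrite -[X in _ --> X](mulr0 c); apply: cvgM; first exact: cvg_cst.
rewrite (_ : (fun n => _) = fun n => (a n)^-1 * ((a n)^-1 * (a n)^-1)).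
  by rewrite -[X in _ --> X](mul0r (0 * 0)); do 2! apply: cvgM => //; exact: inv_a_cvg.
by apply/funext => n; rewrite -!invfM -!expr2.
Qed.

Let u4 : u 4 = (Num.sqrt 2)^-1 + (Num.sqrt 3)^-1 - 11 / 4.
Proof.
have s4 : a 4 = 2 by rewrite (_ : 4%:R = 2 ^+ 2); [rewrite sqrtr_sqr ger0_norm|rewrite -natrX].
by rewrite /u /index_iota /= !big_cons big_nil s4 sqrtr1; field; rewrite !gt_eqF ?sqrtr_gt0.
Qed.

Let inv_sqrt_bounds (x b d : R) : 0 < x -> 0 < b -> 0 < d ->
  b ^+ 2 * x <= 1 -> 1 <= d ^+ 2 * x -> b <= (Num.sqrt x)^-1 <= d.
Proof.
move=> x0 b0 d0 h1 h2; have s0 : 0 < Num.sqrt x by rewrite sqrtr_gt0.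
have s2 : (Num.sqrt x)^-1 ^+ 2 * x = 1.
  by rewrite -{2}(sqr_sqrtr (ltW x0)) -exprMn mulVf ?expr1n// gt_eqF.
have si : 0 < (Num.sqrt x)^-1 by rewrite invr_gt0.
apply/andP; split.
  rewrite -(@ler_pXn2r _ 2) ?nnegrE ?(ltW b0) ?(ltW si)//.
  by rewrite -(ler_pM2r x0) s2.
rewrite -(@ler_pXn2r _ 2) ?nnegrE ?(ltW d0) ?(ltW si)//.
by rewrite -(ler_pM2r x0) s2.
Qed.

Lemma zeta_half_bounds : - (14604 / 10000) < zeta <= - (14603 / 10000).
Proof.
have s4 : a 4 = 2 by rewrite (_ : 4%:R = 2 ^+ 2); [rewrite sqrtr_sqr ger0_norm|rewrite -natrX].
(* In decimals: [0.7071] and [0.70711] around [2 ^ (-1/2)], then [0.57735] and [0.57736] around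
   [3 ^ (-1/2)]. *)
have b2 : 70 / 100 + 71 / 100 / 100 <= (Num.sqrt 2 : R)^-1 <=
    70 / 100 + 71 / 100 / 100 + 10 / 100 / 100 / 100.
  by apply: inv_sqrt_bounds; lra.
have b3 : 57 / 100 + 73 / 100 / 100 + 50 / 100 / 100 / 100 <= (Num.sqrt 3 : R)^-1 <=
    57 / 100 + 73 / 100 / 100 + 60 / 100 / 100 / 100.
  by apply: inv_sqrt_bounds; lra.
move: b2 b3 => /andP[l2 h2] /andP[l3 h3].
have : lo 4 <= zeta by apply: cvg_homo_ge (corr_cvg _) => k; exact: lo_homo.
have : - up 4 <= - zeta.
  apply: (@cvg_homo_ge (fun n => - up n)) (cvgN (corr_cvg _)) => k k4.
  by rewrite lerN2 up_homo// (leq_trans _ k4).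
rewrite /up /lo u4 s4 => H1 H2.
have e1 : 10000 = 100 * 100 :> R by rewrite -natrM.
have e2 : 14603 = 146 * 100 + 3 :> R by rewrite -natrM -natrD.
have e3 : 14604 = 146 * 100 + 4 :> R by rewrite -natrM -natrD.
by rewrite e1 e2 e3 {e1 e2 e3}; apply/andP; split; lra.
Qed.

End zeta_half.

(** * Numerical lower bounds for [pi] and [sqrt (2 pi)] *)

Section pi_bound.
Context {R : realType}.
Implicit Types x y : R.

Let le_of_derive (f g df dg : R -> R) x :
  (forall x, is_derive x 1 f (df x)) -> (forall x, is_derive x 1 g (dg x)) ->
  0 <= x -> f 0 = g 0 -> (forall y, 0 <= y -> df y <= dg y) -> f x <= g x.
Proof.
move=> dfP dgP x0 fg0 dfg.
have := @is_derive_homo _ (fun x => g x - f x) (fun x => dg x - df x) 0 x _ x0.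
rewrite fg0 subrr subr_ge0; apply=> y /andP[y0 _].
by rewrite subr_ge0 dfg.
Qed.

(** Starting from [cos_le1], each Taylor bound for [sin] or [cos] integrates to the next one. *)
Lemma sin_le_taylor5 x : 0 <= x -> sin x <= x - x ^+ 3 / 6 + x ^+ 5 / 120.
Proof.
have dsin (y : R) : is_derive y 1 (sin : R -> R) (cos y) := is_derive_sin y.
have dcos (y : R) : is_derive y 1 (cos : R -> R) (- sin y) := is_derive_cos y.
have h1 y : 0 <= y -> sin y <= y.
  move=> y0; apply: (@le_of_derive sin id cos (fun=> 1)); rewrite ?sin0// => z _; exact: cos_le1.
have h2 y : 0 <= y -> 1 - y ^+ 2 / 2 <= cos y.
  move=> y0; apply: (@le_of_derive (fun y => 1 - y ^+ 2 / 2) cos (fun y => - y) (fun y => - sin y)) => //.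
  - by move=> z; apply: is_derive_eq; rewrite /GRing.scale/=; field.
  - by rewrite expr0n/= mul0r subr0 cos0.
  - by move=> z z0; rewrite lerN2 h1.
have h3 y : 0 <= y -> y - y ^+ 3 / 6 <= sin y.
  move=> y0; apply: (@le_of_derive (fun y => y - y ^+ 3 / 6) sin (fun y => 1 - y ^+ 2 / 2) cos) => //.
  - by move=> z; apply: is_derive_eq; rewrite /GRing.scale/=; field.
  - by rewrite expr0n/= mul0r subr0 sin0.
have h4 y : 0 <= y -> cos y <= 1 - y ^+ 2 / 2 + y ^+ 4 / 24.
  move=> y0; apply: (@le_of_derive cos (fun y => 1 - y ^+ 2 / 2 + y ^+ 4 / 24)
    (fun y => - sin y) (fun y => - (y - y ^+ 3 / 6))) => //.
  - by move=> z; apply: is_derive_eq; rewrite /GRing.scale/=; field.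
  - by rewrite !expr0n/= !mul0r subr0 addr0 cos0.
  - by move=> z z0; rewrite lerN2 h3.
move=> x0; apply: (@le_of_derive sin (fun y => y - y ^+ 3 / 6 + y ^+ 5 / 120)
  cos (fun y => 1 - y ^+ 2 / 2 + y ^+ 4 / 24)) => //.
- by move=> z; apply: is_derive_eq; rewrite /GRing.scale/=; field.
- by rewrite !expr0n/= !mul0r subr0 addr0 sin0.
Qed.

(** For [y = pi / 6], [cos (3 y) = 0] factors as [cos y * (1 - 4 * sin y ^ 2)], and [cos y] is
    positive. *)
Lemma sin_pi6 : sin (pi / 6) = 2^-1 :> R.
Proof.
have p0 := @pi_gt0 R; set y := pi / 6.
have c0 : 0 < cos y by apply: cos_gt0_pihalf; rewrite /y; apply/andP; split; lra.
have s0 : 0 < sin y by apply: sin_gt0_pi; rewrite /y; apply/andP; split; lra.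
have := @cos_pihalf R; rewrite (_ : pi / 2 = y + (y + y)); last by rewrite /y; field.
rewrite !(cosD, sinD) => h.
have h2 : cos y * (1 - 4 * sin y ^+ 2) = 0.
  have := cos2Dsin2 y => e; rewrite -[RHS]h -{1}e; ring.
move/eqP: h2; rewrite mulf_eq0 gt_eqF//= subr_eq0 => /eqP h2.
apply/eqP; rewrite -(@eqrXn2 _ 2) ?ltW// ?invr_ge0//; apply/eqP.
by rewrite exprVn -natrX; move: h2; lra.
Qed.

(** Were [pi] at most [3.141555], the upper Taylor polynomial of [sin], increasing up to [x0], would
    be below [1 / 2] at [pi / 6], against [sin_pi6]. *)
Lemma pi_gt_3141555 : 3 + 14 / 100 + 15 / 100 / 100 + 55 / 100 / 100 / 100 < pi :> R.
Proof.
have p0 := @pi_gt0 R; rewrite ltNge; apply/negP => pile.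
(* [6 * 233 / 445 = 3.14157...], where the Taylor bound is still below [1 / 2]. *)
pose x0 : R := 233 / 445.
have y0 : 0 <= (pi / 6 : R) by rewrite divr_ge0// ltW.
have yx : pi / 6 <= x0 by rewrite /x0; lra.
have := sin_le_taylor5 y0; rewrite sin_pi6.
have := @is_derive_homo _ (fun y => y - y ^+ 3 / 6 + y ^+ 5 / 120)
  (fun y => 1 - y ^+ 2 / 2 + y ^+ 4 / 24) (pi / 6) x0 _ yx.
have -> : (forall y, pi / 6 <= y <= x0 -> 0 <= 1 - y ^+ 2 / 2 + y ^+ 4 / 24) = True.
  apply/propext; split => // _ y /andP[py yx0].
  have y1 : y <= 1 by apply: le_trans yx0 _; rewrite /x0; lra.
  have y00 : 0 <= y by exact: le_trans py.
  have y4 : 0 <= y ^+ 4 by rewrite exprn_ge0.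
  by nra.
move=> /(_ _ I) H1 H2.
have x00 : 0 <= x0 by rewrite /x0; lra.
have : x0 ^+ 2 <= 27 / 100 + 41 / 100 / 100 + 53 / 100 / 100 / 100 by rewrite /x0; lra.
have : 27 / 100 + 41 / 100 / 100 + 52 / 100 / 100 / 100 <= x0 ^+ 2 by rewrite /x0; lra.
have y0' : 0 <= x0 ^+ 2 := sqr_ge0 _.
have {H1 H2} : 2^-1 <= x0 - x0 ^+ 3 / 6 + x0 ^+ 5 / 120.
  apply: le_trans H2 _; apply: H1 => y.
  by apply: is_derive_eq; rewrite /GRing.scale/=; field.
rewrite (_ : x0 - _ + _ = x0 * (1 - x0 ^+ 2 / 6 + (x0 ^+ 2) ^+ 2 / 120)); last by ring.
move: (x0 ^+ 2) y0' => y y0' H yl yh.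
have y2 : y ^+ 2 <= (7 / 100 + 51 / 100 / 100 + 60 / 100 / 100 / 100) by nra.
have : 1 - y / 6 + y ^+ 2 / 120 <=
  1 - (27 / 100 + 41 / 100 / 100 + 52 / 100 / 100 / 100) / 6 + (7 / 100 + 51 / 100 / 100 + 60 / 100 / 100 / 100) / 120 by lra.
move=> /(ler_wpM2l x00) /(le_trans H); rewrite /x0; lra.
Qed.

(** The bound [2.506613] lies just above [2.5397 / 1.0132], the value that [numeric_bound]
    requires. *)
Lemma sqrt_2pi_gt : 25 / 10 + 66 / 100 / 100 + 13 / 100 / 100 / 100 < Num.sqrt (2 * pi) :> R.
Proof.
have s2 : Num.sqrt (2 * pi) ^+ 2 = 2 * pi :> R.
  by rewrite sqr_sqrtr// mulr_ge0// ltW// pi_gt0.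
rewrite ltNge; apply/negP => sc; have s0 := ltW (@sqrt_2pi_gt0 R).
have := ler_pM s0 s0 sc sc; rewrite -expr2 s2; have := pi_gt_3141555.
by move: (pi : R) => p pg sc2; lra.
Qed.

End pi_bound.

(** * The absolute third moment of the standardized binomial law *)

Section third_moment.
Context {R : realType}.
Implicit Types (n k m : nat).

Lemma powR_half (x : R) : 0 <= x -> x `^ (1 / 2) = Num.sqrt x.
Proof. by move=> x0; rewrite mul1r powR12_sqrt. Qed.

Lemma powR_three_half (x : R) : 0 <= x -> x `^ (3 / 2) = Num.sqrt x ^+ 3.
Proof.
move=> x0; rewrite (_ : 3 / 2 = 2^-1 * 3%:R); last by rewrite mulrC.
by rewrite powRrM powR12_sqrt// powR_mulrn// sqrtr_ge0.
Qed.

Let A n k : R := k%:R * 'C(n, k)%:R * ((2 * k%:R - n%:R - 1) ^+ 2 + 2 * n%:R - 1).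

Let A_diff n k : (k <= n)%N ->
  A n k - A n k.+1 = 'C(n, k)%:R * (2 * k%:R - n%:R) ^+ 3.
Proof.
move=> kn; have := congr1 (fun i => i%:R : R) (mul_bin_left n k).
rewrite !natrM natrB// => h.
have -> : A n k.+1 = (k.+1%:R * 'C(n, k.+1)%:R) *
  ((2 * k.+1%:R - n%:R - 1) ^+ 2 + 2 * n%:R - 1) by [].
rewrite h /A -[k.+1%:R]natr1; ring.
Qed.

(* [k 'C(n, k) ((2 k - n - 1) ^ 2 + 2 n - 1)] is a discrete primitive of
   [- 'C(n, k) (2 k - n) ^ 3], so that the sum telescopes on each side of [n / 2]. *)
Lemma sum_binomial_abs_cube n m : (m <= n.+1)%N ->
  (forall k, (k < m)%N -> (2 * k <= n)%N) -> (forall k, (m <= k)%N -> (n <= 2 * k)%N) ->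
  \sum_(k < n.+1) 'C(n, k)%:R * `|2 * k%:R - n%:R| ^+ 3 =
  2 * (m%:R * 'C(n, m)%:R * ((2 * m%:R - n%:R - 1) ^+ 2 + 2 * n%:R - 1)) :> R.
Proof.
move=> mn lo hi; rewrite -/(A n m).
rewrite -(big_mkord xpredT (fun k => 'C(n, k)%:R * `|2 * k%:R - n%:R| ^+ 3)) (big_cat_nat _ mn)//=.
have -> : \sum_(0 <= k < m) 'C(n, k)%:R * `|2 * k%:R - n%:R| ^+ 3 = A n m - A n 0.
  rewrite -telescope_sumr//; apply: eq_big_nat => k /andP[_ km].
  rewrite -[RHS]opprB A_diff; last by have := lo k km; lia.
  rewrite ler0_norm; first by rewrite exprNn -signr_odd/=; ring.
  by rewrite subr_le0 -natrM ler_nat lo.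
have -> : \sum_(m <= k < n.+1) 'C(n, k)%:R * `|2 * k%:R - n%:R| ^+ 3 = A n m - A n n.+1.
  rewrite -opprB -telescope_sumr// -sumrN; apply: eq_big_nat => k /andP[mk kn].
  rewrite opprB A_diff// ger0_norm// subr_ge0 -natrM ler_nat; exact: hi.
have -> : A n 0 = 0 by rewrite /A !mul0r.
have -> : A n n.+1 = 0 by rewrite /A bin_small// mulr0 mul0r.
by ring.
Qed.

Lemma binomial_E_abs_cube n m : (0 < n)%N -> (m <= n.+1)%N ->
  (forall k, (k < m)%N -> (2 * k <= n)%N) -> (forall k, (m <= k)%N -> (n <= 2 * k)%N) ->
  binomial_E n (fun x : R => `|x| ^+ 3 / 6) =
  2 * m%:R * ((2 * m%:R - n%:R - 1) ^+ 2 + 2 * n%:R - 1)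
    * b_half n m / (6 * Num.sqrt n%:R ^+ 3).
Proof.
move=> n0 mn lo hi; have s0 : 0 < Num.sqrt n%:R :> R by rewrite sqrtr_gt0 ltr0n.
transitivity ((\sum_(k < n.+1) 'C(n, k)%:R * `|2 * k%:R - n%:R| ^+ 3)
    / (2 ^+ n * 6 * Num.sqrt n%:R ^+ 3) : R).
  rewrite mulr_suml; apply: eq_bigr => k _.
  rewrite /b_half normrM normfV (ger0_norm (ltW s0)) exprMn exprVn.
  by field; rewrite !gt_eqF// exprn_gt0.
rewrite (sum_binomial_abs_cube mn lo hi) /b_half.
by field; rewrite !gt_eqF// exprn_gt0.
Qed.

Lemma L_abs_cube n : (0 < n)%N ->
  L n = `|binomial_E n (fun x : R => `|x| ^+ 3 / 6) - normal_E (fun x : R => `|x| ^+ 3 / 6)|.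
Proof.
move=> n0; have s0 : 0 < Num.sqrt n%:R :> R by rewrite sqrtr_gt0 ltr0n.
have s2 : Num.sqrt n%:R ^+ 2 = n%:R :> R by rewrite sqr_sqrtr.
have p0 := @sqrt_2pi_gt0 R.
have -> : normal_E (fun x : R => `|x| ^+ 3 / 6) = 6^-1 * (4 / Num.sqrt (2 * pi)).
  rewrite -normal_E_abs3 -normal_EZ; last by apply/tameX/tame_abs; exact: tame_id.
  by apply: eq_normal_E => x; rewrite mulrC.
suff -> : binomial_E n (fun x : R => `|x| ^+ 3 / 6) = 6^-1 *
  (if odd n then (2 * n%:R `^ (1 / 2) + n%:R `^ (- (1 / 2)) - n%:R `^ (- (3 / 2)))
        * b_half n n./2 else 2 * n%:R `^ (1 / 2) * b_half n n./2).
  by rewrite -mulrBr normrM (ger0_norm (_ : 0 <= 6^-1)) ?invr_ge0// /L; case: odd.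
rewrite !powRN powR_half// powR_three_half//.
case: ifPn => no.
(* For odd [n] the sum splits at [(n + 1) / 2]; the symmetry of the binomial coefficients brings the
   index back to [n./2]. *)
- rewrite (@binomial_E_abs_cube n n./2.+1)//; [|lia|move=> k; lia|move=> k; lia].
  have -> : b_half n n./2.+1 = b_half n n./2 :> R.
    rewrite /b_half (_ : 'C(n, n./2.+1) = 'C(n, n./2))//.
    by rewrite -bin_sub; [congr 'C(_, _); lia|lia].
  have -> : 2 * n./2.+1%:R = n%:R + 1 :> R by rewrite -natrM natr1; congr (_%:R); lia.
  move: (b_half _ _ : R) (Num.sqrt n%:R) s0 s2 => b s s0 <-.
  by field; rewrite gt_eqF.
- rewrite (@binomial_E_abs_cube n n./2)//; [|lia|move=> k; lia|move=> k; lia].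
  have -> : 2 * n./2%:R = n%:R :> R by rewrite -natrM; congr (_%:R); lia.
  move: (b_half _ _ : R) (Num.sqrt n%:R) s0 s2 => b s s0 <-.
  by field; rewrite gt_eqF.
Qed.

Let abs_cube (x : R) : R := `|x| ^+ 3 / 6.

Let tame_abs_cube : tame abs_cube.
Proof. by apply: tameM; [apply/tameX/tame_abs; exact: tame_id|exact: tame_cst]. Qed.

Lemma L_integral n : (0 < n)%N -> ((L n : R)%:E =
  `|\int[std_binomial n]_x (`|x| ^+ 3 / 6)%:E - \int[std_normal]_x (`|x| ^+ 3 / 6)%:E|)%E.
Proof.
move=> n0; rewrite (EFin_normal_E tame_abs_cube).
by rewrite (integral_std_binomial n (tame_measurable tame_abs_cube)) L_abs_cube.
Qed.

Lemma L_le_zolotarev n : (0 < n)%N ->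
  ((L n : R)%:E <= zolotarev3 (std_binomial n) std_normal)%E.
Proof. by move=> n0; rewrite L_abs_cube//; exact: le_zolotarev_abs_cube. Qed.

End third_moment.

(** * The explicit upper bounds *)

Section final_bounds.
Context {R : realType}.
Implicit Types (n m : nat).

Let s2p : R := Num.sqrt (2 * pi).
Let zeta : R := riemann_zeta (1 / 2).

Lemma zolotarev_std_binomial_lt n : (0 < n)%N ->
  (zolotarev3 (@std_binomial R n) std_normal <
   ((3 * s2p * n%:R)^-1 + ((4 + zeta) / s2p - 1) / (6 * n%:R `^ (3 / 2)))%:E)%E.
Proof.
move=> n0; apply: le_lt_trans (zolotarev_std_binomial_le n0) _; rewrite lte_fin.
have := @sum_inv_sqrt_lt R n n0; rewrite powR_three_half// -/zeta.
have s0 : 0 < Num.sqrt n%:R :> R by rewrite sqrtr_gt0 ltr0n.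
have s2 : Num.sqrt n%:R ^+ 2 = n%:R :> R by rewrite sqr_sqrtr.
have p0 : 0 < s2p := sqrt_2pi_gt0.
rewrite -/s2p; move: (\sum_(_ <= _ < _) _) (Num.sqrt n%:R) s0 s2 => S s s0 <- Slt.
have -> : (3 * s2p * s ^+ 2)^-1 + ((4 + zeta) / s2p - 1) / (6 * s ^+ 3) =
  (6 * s ^+ 2 * s)^-1 * ((4 / s2p - 1) + s2p^-1 * (2 * s + zeta)).
  by field; rewrite !gt_eqF.
rewrite ltr_pM2l ?invr_gt0 ?mulr_gt0 ?exprn_gt0//.
by rewrite ltrD2l ltr_pM2l ?invr_gt0.
Qed.

(** Termwise comparison: the first term needs [0.399 * s2p > 1], the second
    [4 + zeta <= 1.0132 * s2p]. *)
Lemma numeric_bound n : (0 < n)%N ->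
  (3 * s2p * n%:R)^-1 + ((4 + zeta) / s2p - 1) / (6 * n%:R `^ (3 / 2)) <
  1330 / 10000 / n%:R + 22 / 10000 / n%:R `^ (3 / 2).
Proof.
move=> n0; have n0' : 0 < n%:R :> R by rewrite ltr0n.
have t0 : 0 < n%:R `^ (3 / 2) :> R by rewrite powR_gt0.
have /andP[_ z] := @zeta_half_bounds R; have sp := @sqrt_2pi_gt R.
have p0 : 0 < s2p := sqrt_2pi_gt0.
rewrite -/zeta in z; rewrite -/s2p in sp.
have e1 : 1330 = 13 * 100 + 30 :> R by rewrite -natrM -natrD.
have e2 : 10000 = 100 * 100 :> R by rewrite -natrM.
have h1 : 1 < 1330 / 10000 * (3 * s2p).
  by rewrite e1 e2 {e1 e2}; move: s2p sp p0 => S sp p0; lra.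
have h2 : 4 + zeta <= (6 * (22 / 10000) + 1) * s2p.
  have e3 : 14603 = 146 * 100 + 3 :> R by rewrite -natrM -natrD.
  rewrite e2 e3 in z; rewrite e2 {e1 e2 e3 h1}.
  by move: s2p zeta sp p0 z => S zt sp p0 z; lra.
move: (1330 / 10000 : R) (22 / 10000 : R) h1 h2 => A B h1 h2.
apply: ltr_leD.
- rewrite invfM ltr_pM2r ?invr_gt0//.
  by rewrite -(ltr_pM2r (_ : 0 < 3 * s2p)) ?mulVf ?gt_eqF ?mulr_gt0.
- rewrite invfM mulrA ler_pM2r ?invr_gt0//.
  rewrite ler_pdivrMr// lerBlDr ler_pdivrMr//; by rewrite (mulrC B).
Qed.

Lemma numeric_bound_le n : (0 < n)%N ->
  1330 / 10000 / n%:R + 22 / 10000 / n%:R `^ (3 / 2) <= 1352 / 10000 / n%:R :> R.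
Proof.
move=> n0; have n0' : 0 < n%:R :> R by rewrite ltr0n.
have t0 : 0 < n%:R `^ (3 / 2) :> R by rewrite powR_gt0.
have : (n%:R `^ (3 / 2))^-1 <= n%:R^-1 :> R.
  rewrite lef_pV2 ?posrE// -[leLHS]powRr1 ?(ltW n0')//.
  by apply: ler_powR; [rewrite ler1n|lra].
have -> : 1352 = 1330 + 22 :> R by rewrite -natrD.
have B0 : 0 <= 22 / 10000 :> R := divr_ge0 (ler0n _ _) (ler0n _ _).
have gen (A B C x y : R) : 0 <= B / C -> x <= y -> A / C * y + B / C * x <= (A + B) / C * y.
  by move=> BC xy; rewrite !mulrDl lerD2l; exact: ler_wpM2l.
exact: gen B0.
Qed.

(** The lower and upper estimates of the distance combine into a decay rate for [L], which [c_cvg]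
    turns into a limit. *)
Lemma L_le n : (0 < n)%N -> L n <= 1352 / 10000 / n%:R :> R.
Proof.
move=> n0; apply: ltW; apply: lt_le_trans (numeric_bound_le n0).
apply: lt_trans (numeric_bound n0); rewrite -lte_fin.
exact: le_lt_trans (L_le_zolotarev n0) (zolotarev_std_binomial_lt n0).
Qed.

End final_bounds.

(** * Expansion of [L] through central binomial probabilities *)

Section asymptotics.
Context {R : realType}.
Implicit Types (n m : nat).

(** The absolute third moment of the normal law. *)
Let kappa : R := 4 / Num.sqrt (2 * pi).
Let kappa_gt0 : 0 < kappa. Proof. by rewrite divr_gt0// sqrt_2pi_gt0. Qed.

Let b m : R := b_half (2 * m) m.
(** For [0 < m], the absolute third moment of the standardized binomial law with [n = 2 m]. *)
Let c m : R := 2 * Num.sqrt (2 * m)%:R * b m.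

Let b_gt0 m : 0 < b m.
Proof. by rewrite divr_gt0 ?exprn_gt0// ltr0n bin_gt0; lia. Qed.

Let bin_odd_central m : 'C(2 * m.+1, m.+1) = (2 * 'C((2 * m).+1, m))%N.
Proof.
have := mul_bin_diag (2 * m.+1) m; rewrite (_ : (2 * m.+1).-1 = (2 * m).+1)%N; last by lia.
by nia.
Qed.

(** Reduces odd [n] to the even index [n + 1]. *)
Lemma b_half_odd_central m : b_half (2 * m).+1 m = b m.+1.
Proof.
rewrite /b /b_half bin_odd_central natrM (_ : (2 * m.+1 = (2 * m).+2)%N); last by lia.
by rewrite [in RHS]exprS; field; rewrite gt_eqF// exprn_gt0.
Qed.

Let bS m : b m.+1 = b m * ((2 * m%:R + 1) / (2 * (m%:R + 1))).
Proof.
have h1 := mul_bin_diag (2 * m).+1 m.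
have h2 : 'C((2 * m).+1, m.+1) = 'C((2 * m).+1, m).
  by rewrite -bin_sub; [congr 'C(_, _); lia|lia].
have := congr1 (fun i => i%:R : R) h1; rewrite /= h2 !natrM -natr1 natrM -[m.+1%:R]natr1 => h.
have m1 : 0 < m%:R + 1 :> R by rewrite ltr_wpDl.
rewrite -b_half_odd_central /b /b_half exprS.
have -> : 'C((2 * m).+1, m)%:R = (2 * m%:R + 1) * 'C(2 * m, m)%:R / (m%:R + 1) :> R.
  by rewrite h; field; rewrite gt_eqF.
by field; rewrite !gt_eqF// exprn_gt0.
Qed.

Let c_sqr m : c m ^+ 2 = 8 * m%:R * b m ^+ 2.
Proof. by rewrite !exprMn sqr_sqrtr// natrM; ring. Qed.

Let c_ge0 m : 0 <= c m. Proof. by rewrite mulr_ge0 ?(ltW (b_gt0 m)). Qed.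

Let L_even m : (0 < m)%N -> L (2 * m) = 6^-1 * `|c m - kappa|.
Proof.
move=> m0; rewrite /L (_ : odd (2 * m) = false); last by lia.
by rewrite (_ : (2 * m)./2 = m); [rewrite powR_half|lia].
Qed.

Let inv_cvg : (m%:R : R)^-1 @[m --> \oo] --> (0 : R).
Proof. by rewrite -cvg_shiftS; exact: cvg_harmonic. Qed.

Let c_cvg : c @ \oo --> kappa.
Proof.
apply/cvgrPdist_le => e e0; near=> m.
have m0 : (0 < m)%N by near: m; exact: nbhs_infty_gt.
have m2 : (0 < 2 * m)%N by lia.
have := @L_le R _ m2; rewrite L_even// distrC natrM => h.
have : (m%:R : R)^-1 <= e.
  rewrite invf_ple ?posrE ?ltr0n//; near: m; exact: nbhs_infty_ger.
(* Replacing [0.1352] by the cruder [1 / 3] yields [|c m - kappa| <= m^-1]. *)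
have ratio_le (i j : nat) : (0 < j)%N -> (3 * i <= j)%N -> i%:R / j%:R <= 3^-1 :> R.
  move=> j0 ij; rewrite ler_pdivrMr ?ltr0n// mulrC ler_pdivlMr// mulrC.
  by rewrite -natrM ler_nat.
have h1 := @ratio_le 1352%N 10000%N isT isT.
have h2 : 0 <= (2 * m%:R)^-1 :> R by rewrite invr_ge0 mulr_ge0.
move: (le_trans h (ler_wpM2r h2 h1)); rewrite invfM.
by move: (`|_|) (m%:R^-1) => x y {h h1}; lra.
Unshelve. all: by end_near. Qed.

(* [W] increases and [V] decreases to [kappa ^ 2], which gives the expansion of
   the central binomial coefficient up to order [m ^ -2]. *)
Let W m : R := c m ^+ 2 * (1 + 4^-1 * m%:R^-1).
Let V m : R := c m ^+ 2 * (1 + 4^-1 * m%:R^-1 + 32^-1 * (m%:R^-1 * m%:R^-1)).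

Let c2_cvg (u : nat -> R) : u @ \oo --> (1 : R) -> (fun m => c m ^+ 2 * u m) @ \oo --> kappa ^+ 2.
Proof.
move=> u1; rewrite -[X in _ --> X]mulr1; apply: cvgM => //.
by rewrite expr2; under eq_fun do rewrite expr2; apply: cvgM.
Qed.

Let u_cvg : 1 + 4^-1 * (m%:R : R)^-1 @[m --> \oo] --> (1 : R).
Proof.
rewrite -[X in _ --> X]addr0; apply: cvgD; first exact: cvg_cst.
by rewrite -[X in _ --> X](mulr0 4^-1); apply: cvgM => //; exact: cvg_cst.
Qed.

Let W_le m : (0 < m)%N -> W m <= kappa ^+ 2.
Proof.
move=> m0; apply: (@cvg_homo_ge R W _ m _ (c2_cvg u_cvg)) => k mk.
have k0 : 0 < k%:R :> R by rewrite ltr0n (leq_trans m0).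
rewrite /W !c_sqr bS -[k.+1%:R]natr1; move: (k%:R) (b k) k0 (b_gt0 k) => x y x0 y0.
have x1 : 0 < x + 1 by lra.
rewrite -subr_ge0 (_ : _ - _ = y ^+ 2 / (2 * (x + 1) ^+ 2)).
  by rewrite divr_ge0 ?mulr_ge0 ?exprn_ge0 ?ltW.
by field; rewrite !gt_eqF.
Qed.

Let V_ge m : (0 < m)%N -> kappa ^+ 2 <= V m.
Proof.
move=> m0; rewrite -lerN2; apply: (@cvg_homo_ge R (fun m => - V m) _ m) => [k mk|].
  have k0 : 0 < k%:R :> R by rewrite ltr0n (leq_trans m0).
  rewrite lerN2 /V !c_sqr bS -[k.+1%:R]natr1; move: (k%:R) (b k) k0 (b_gt0 k) => x y x0 y0.
  have x1 : 0 < x + 1 by lra.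
  rewrite -subr_ge0 (_ : _ - _ = y ^+ 2 * (3 * x + 4) / (16 * x * (x + 1) ^+ 3)).
    have h1 : 0 <= 3 * x + 4 by lra.
    have h3 : 0 <= 16 * x * (x + 1) ^+ 3.
      by rewrite mulr_ge0 ?exprn_ge0 ?mulr_ge0 ?ltW.
    exact: divr_ge0 (mulr_ge0 (sqr_ge0 y) h1) h3.
  by field; rewrite !gt_eqF.
apply: cvgN; apply: c2_cvg; rewrite -[X in _ --> X]addr0; apply: cvgD => //.
rewrite -[X in _ --> X](mulr0 32^-1); apply: cvgM; first exact: cvg_cst.
by rewrite -[X in _ --> X](mulr0 0); apply: cvgM.
Qed.

(** In terms of [t], [W_le] and [V_ge] read [c ^ 2 (1 + 2 t) <= kappa ^ 2 <= c ^ 2 (1 + 2 t + 2 t ^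
    2)]; the claimed bounds are checked after squaring. *)
Let c_bounds m t : (0 < m)%N -> t = (8 * m%:R)^-1 ->
  [/\ 0 < t, t <= 1 / 8, kappa * (1 - t) <= c m & c m <= kappa * (1 - t + 3 * t ^+ 2)].
Proof.
move=> m0 te; have m0' : 1 <= m%:R :> R by rewrite ler1n.
have M0 : 0 < 8 * m%:R :> R by lra.
have t0 : 0 < t by rewrite te invr_gt0.
have t1 : t <= 1 / 8.
  by rewrite te -(ler_pM2r M0) mulVf ?gt_eqF//; lra.
have hW := W_le m0; have hV := V_ge m0.
have em : m%:R^-1 = 8 * t :> R by rewrite te invfM mulrA mulfV ?mul1r.
rewrite /W em in hW; rewrite /V em in hV.
have k2 := sqr_ge0 kappa.
have k0 := ltW kappa_gt0; have cm := c_ge0 m.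
have t2 : 0 <= t ^+ 2 := sqr_ge0 t.
have tt : t ^+ 2 <= 1 / 8 * t by rewrite expr2 ler_pM2r.
have t3 : 0 <= t ^+ 3 by rewrite exprn_ge0 ?ltW.
have pos1 : 0 <= 1 - t by lra.
have pos2 : 0 <= 1 - t + 3 * t ^+ 2 by lra.
move: (c m) cm hW hV => x cm hW hV; split=> //.
- rewrite -(@ler_pXn2r _ 2) ?nnegrE ?(mulr_ge0 k0 pos1)// exprMn.
  have d0 : 0 < 1 + 2 * t + 2 * t ^+ 2 by lra.
  rewrite -(ler_pM2r d0); apply: le_trans (_ : kappa ^+ 2 * 1 <= _).
    rewrite -mulrA; apply: ler_wpM2l => //.
    have -> : (1 - t) ^+ 2 * (1 + 2 * t + 2 * t ^+ 2) =
      1 - t ^+ 2 * (1 + 2 * (t * (1 - t))) by ring.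
    have h := mulr_ge0 (ltW t0) pos1.
    have h' : 0 <= 1 + 2 * (t * (1 - t)) by lra.
    by have := mulr_ge0 t2 h'; lra.
  rewrite mulr1; apply: le_trans hV _; rewrite le_eqVlt; apply/orP; left; apply/eqP.
  by field.
- rewrite -(@ler_pXn2r _ 2) ?nnegrE ?(mulr_ge0 k0 pos2)// exprMn.
  have d0 : 0 < 1 + 2 * t by lra.
  rewrite -(ler_pM2r d0); apply: le_trans (_ : kappa ^+ 2 * 1 <= _).
    rewrite mulr1; apply: le_trans hW; rewrite le_eqVlt; apply/orP; left; apply/eqP.
    by field.
  rewrite -[leRHS]mulrA; apply: ler_wpM2l => //.
  have -> : (1 - t + 3 * t ^+ 2) ^+ 2 * (1 + 2 * t) =
    1 + t ^+ 2 * (3 + 8 * t - 3 * t ^+ 2) + 18 * (t ^+ 3 * t ^+ 2) by ring.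
  have h : 0 <= 3 + 8 * t - 3 * t ^+ 2 by lra.
  have h1 := mulr_ge0 t2 h; have h2 := mulr_ge0 t3 t2; lra.
Qed.

Let main_term n : (6 * Num.sqrt (2 * pi) * n%:R)^-1 = kappa * n%:R^-1 / 24 :> R.
Proof.
have S0 := @sqrt_2pi_gt0 R; rewrite /kappa; case: n => [|n]; first by rewrite mulr0 !invr0 !(mulr0, mul0r).
by field; rewrite !gt_eqF// ltr0n.
Qed.

(** Here [t = (4 n)^-1] for [n = 2 m], so the main term is [kappa * t / 6]; [c_bounds] leaves an
    error of at most [kappa * t ^ 2 / 2]. *)
Let L_asymptotic_even m : (0 < m)%N ->
  `|L (2 * m) - kappa * (2 * m)%:R^-1 / 24| <= kappa / (2 * m)%:R ^+ 2.
Proof.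
move=> m0; have m0' : 0 < m%:R :> R by rewrite ltr0n.
have [t0 t1] := c_bounds m0 erefl; set t := (_)^-1 in t0 t1 *.
have eN : (2 * m)%:R^-1 = 4 * t :> R.
  by rewrite natrM /t; field; rewrite gt_eqF.
rewrite L_even// -exprVn eN; move: t t0 t1 {eN} => t t0 t1 h1 h2.
have k0 := kappa_gt0; have kt := mulr_gt0 k0 t0.
have ktt : kappa * t ^+ 2 <= 1 / 8 * (kappa * t).
  by rewrite expr2 mulrCA ler_pM2r// mulrC; lra.
have ktt0 : 0 <= kappa * t ^+ 2 by rewrite mulr_ge0 ?sqr_ge0 ?ltW.
have E1 : kappa * (1 - t) = kappa - kappa * t by ring.
have E2 : kappa * (1 - t + 3 * t ^+ 2) = kappa - kappa * t + 3 * (kappa * t ^+ 2) by ring.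
have E3 : kappa * (4 * t) / 24 = 6^-1 * (kappa * t) by field.
have E4 : kappa * (4 * t) ^+ 2 = 16 * (kappa * t ^+ 2) by ring.
rewrite E1 in h1; rewrite E2 in h2; rewrite E3 E4.
have h3 : c m - kappa <= 0 by lra.
rewrite (ler0_norm h3).
by rewrite ler_norml; apply/andP; split; lra.
Qed.

Let L_asymptotic_odd m :
  `|L (2 * m).+1 - kappa * (2 * m).+1%:R^-1 / 24| <= kappa / (2 * m).+1%:R ^+ 2.
Proof.
have m0' : 0 < m.+1%:R :> R by rewrite ltr0n.
have [t0 t1] := @c_bounds m.+1 _ isT erefl; set t := (_)^-1 in t0 t1 *.
set n := (2 * m).+1; have N1 : 1 <= n%:R :> R by rewrite ler1n.
have nE : n%:R + 1 = 2 * m.+1%:R :> R by rewrite natr1 -natrM /n; congr (_%:R); lia.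
have tE : t = (4 * (n%:R + 1))^-1 by rewrite nE mulrA -natrM.
pose s : R := Num.sqrt n%:R; pose w : R := Num.sqrt (2 * m.+1)%:R.
have s2 : s ^+ 2 = n%:R by rewrite sqr_sqrtr.
have w2 : w ^+ 2 = n%:R + 1 by rewrite sqr_sqrtr// natrM nE.
have s0 : 0 < s by rewrite sqrtr_gt0 ltr0n.
have w0 : 0 < w by rewrite sqrtr_gt0 ltr0n; lia.
(* The moment for odd [n] is [r] times the moment [c m.+1] for [n + 1], and [r] lies between
   [1 - n ^ -2] and [1]. *)
pose r := w * (2 * n%:R - 1) / (2 * s ^+ 3).
have r0 : 0 <= r.
  have h : 0 <= 2 * n%:R - 1 :> R by lra.
  have h' : 0 <= 2 * s ^+ 3 by rewrite mulr_ge0 ?exprn_ge0 ?ltW.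
  exact: divr_ge0 (mulr_ge0 (ltW w0) h) h'.
have r2 : r ^+ 2 = (4 * n%:R ^+ 3 - 3 * n%:R + 1) / (4 * n%:R ^+ 3).
  have -> : r ^+ 2 = w ^+ 2 * (2 * n%:R - 1) ^+ 2 / (4 * (s ^+ 2) ^+ 3).
    by rewrite /r; field; rewrite gt_eqF.
  by rewrite w2 s2; field; rewrite gt_eqF//; lra.
have dE : L n = 6^-1 * `|c m.+1 * r - kappa|.
  rewrite /L (_ : odd n = true); last by rewrite /n; lia.
  rewrite !powRN powR_half// powR_three_half// -/s (_ : n./2 = m); last by rewrite /n; lia.
  rewrite b_half_odd_central -/kappa; congr (_ * `|_ - _|).
  rewrite /c -/w /r.
  have -> : 2 * w * b m.+1 * (w * (2 * n%:R - 1) / (2 * s ^+ 3)) =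
    w ^+ 2 * (2 * n%:R - 1) * b m.+1 / s ^+ 3 by field; rewrite gt_eqF.
  by rewrite w2 -s2; field; rewrite gt_eqF.
rewrite dE -exprVn; move: n%:R N1 tE r2 {nE s2 w2 dE} => N N1 tE r2.
have N0 : 0 < N by lra.
have N3 : 0 < 4 * N ^+ 3 by rewrite mulr_gt0 ?exprn_gt0.
have e0 : 0 < N^-1 by rewrite invr_gt0.
have e2le : N^-1 ^+ 2 <= 1 by rewrite exprn_ile1 ?(ltW e0)// invf_le1.
have r_le1 : r <= 1.
  rewrite -(@ler_pXn2r _ 2) ?nnegrE// expr1n r2 ler_pdivrMr// mul1r; lra.
have r_ge : 1 - N^-1 ^+ 2 <= r.
  rewrite -(@ler_pXn2r _ 2) ?nnegrE ?subr_ge0// r2 ler_pdivlMr//.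
  have -> : (1 - N^-1 ^+ 2) ^+ 2 * (4 * N ^+ 3) = 4 * N ^+ 3 - 8 * N + 4 * N^-1.
    by field; rewrite gt_eqF.
  have : N^-1 <= 1 by rewrite invf_le1.
  lra.
(* Replaces [t = (4 (n + 1))^-1] by [(4 n)^-1] up to a term of second order. *)
have tN : t = N^-1 / 4 - N^-1 * t.
  by rewrite tE; field; rewrite !gt_eqF//; lra.
move: (N^-1) e0 e2le r_ge tN => e e0 e2le r_ge tN h1 h2.
have k0 := kappa_gt0; have c0 := c_ge0 m.+1.
have et0 : 0 <= e * t by rewrite mulr_ge0// ltW.
have te : t <= e / 4 by lra.
have ket : kappa * (e * t) <= kappa * (e ^+ 2 / 4).
  by rewrite ler_pM2l// expr2 -mulrA ler_pM2l.
have ktt : kappa * t ^+ 2 <= kappa * (e ^+ 2 / 16).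
  rewrite ler_pM2l//; have := ler_pM (ltW t0) (ltW t0) te te.
  by rewrite -!expr2 expr_div_n; lra.
have kt8 : kappa * t ^+ 2 <= kappa * (t / 8) by rewrite ler_pM2l// expr2; nra.
have ket0 := mulr_ge0 (ltW k0) et0; have kt0 := mulr_gt0 k0 t0.
have kee0 : 0 <= kappa * e ^+ 2 by rewrite mulr_ge0 ?sqr_ge0 ?ltW.
have kte0 : 0 <= kappa * t * e ^+ 2 by rewrite mulr_ge0 ?sqr_ge0 ?ltW.
have up : c m.+1 * r <= kappa * (1 - t + 3 * t ^+ 2).
  by apply: le_trans h2; rewrite ler_piMr.
have lo : kappa * (1 - t) * (1 - e ^+ 2) <= c m.+1 * r.
  by apply: ler_pM => //; rewrite ?subr_ge0// mulr_ge0 ?(ltW k0)// subr_ge0; lra.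
have ktN : kappa * t = kappa * e / 4 - kappa * (e * t) by rewrite {1}tN; ring.
have E1 : kappa * (1 - t) * (1 - e ^+ 2) =
  kappa - kappa * t - kappa * e ^+ 2 + kappa * t * e ^+ 2 by ring.
have E2 : kappa * (1 - t + 3 * t ^+ 2) = kappa - kappa * t + 3 * (kappa * t ^+ 2) by ring.
rewrite E1 in lo; rewrite E2 in up.
have h3 : c m.+1 * r - kappa <= 0 by lra.
rewrite (ler0_norm h3).
by rewrite ler_norml; apply/andP; split; lra.
Qed.

Lemma L_asymptotic n : (0 < n)%N ->
  `|L n - (6 * Num.sqrt (2 * pi) * n%:R)^-1| <= kappa / n%:R ^+ 2.
Proof.
move=> n0; rewrite main_term; case: (boolP (odd n)) => no.
  have -> : n = (2 * n./2).+1 by lia.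
  exact: L_asymptotic_odd.
have -> : n = (2 * n./2)%N by lia.
by apply: L_asymptotic_even; lia.
Qed.

Lemma L_bigO : (fun n : nat => L n - (6 * Num.sqrt (2 * pi) * n%:R)^-1 : R)
  =O_\oo (fun n : nat => (n%:R ^+ 2)^-1 : R).
Proof.
apply/eqO_exP; exists kappa => //; near=> n.
have h : 0 <= (n%:R ^+ 2)^-1 :> R by rewrite invr_ge0 sqr_ge0.
rewrite (ger0_norm h).
apply: L_asymptotic; near: n; exact: nbhs_infty_gt.
Unshelve. all: by end_near. Qed.

End asymptotics.

Theorem theorem1p10 (R : realType) :
  [/\ (fun n : nat => L n - (6 * Num.sqrt (2 * pi) * n%:R)^-1 : R)
        =O_\oo (fun n : nat => (n%:R ^+ 2)^-1 : R),
      (forall n : nat, (0 < n)%N ->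
        let eps : \bar R := zolotarev3 (std_binomial n) std_normal in
        let bound1 : R := (3 * Num.sqrt (2 * pi) * n%:R)^-1
          + ((4 + riemann_zeta (1 / 2)) / Num.sqrt (2 * pi) - 1)
            / (6 * n%:R `^ (3 / 2)) in
        let bound2 : R :=
          1330 / 10000 / n%:R + 22 / 10000 / n%:R `^ (3 / 2) in
        [/\ ((L n : R)%:E = `|\int[std_binomial n]_x (`|x| ^+ 3 / 6)%:E
                          - \int[std_normal]_x (`|x| ^+ 3 / 6)%:E|)%E,
            ((L n : R)%:E <= eps)%E,
            (eps < bound1%:E)%E,
            bound1 < bound2 &
            bound2 <= 1352 / 10000 / n%:R]) &
      - (14604 / 10000) < riemann_zeta (1 / 2 : R) <= - (14603 / 10000)].
Proof.
split; first exact: L_bigO.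
- move=> n n0 eps bound1 bound2; split.
  + exact: L_integral.
  + exact: L_le_zolotarev.
  + exact: zolotarev_std_binomial_lt.
  + exact: numeric_bound.
  + exact: numeric_bound_le.
- exact: zeta_half_bounds.
Qed.
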